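(* Let $a,b,c\in\mathbb R$, let $\hat u_1,\hat u_2,\hat p_{u_1},\hat p_{u_2}$ be the canonical variables on $T^*\mathbb R^2$ defined in the context, and put $$\lambda_i=\frac12\left(\hat u_i^4\hat p_{u_i}^2+\frac{a}{\hat u_i^2}+\frac{b}{\hat u_i^3}+\frac{c}{\hat u_i^4}\right),\qquad i=1,2.$$ Then the functions $$\hat H_1=\lambda_1+\lambda_2,\qquad \hat H_2=(\lambda_1-\lambda_2)^2$$ are in involution with respect to each of the two brackets $$\{\hat u_i,\hat p_{u_j}\}=\delta_{ij},\qquad \{\hat u_1,\hat u_2\}=\{\hat p_{u_1},\hat p_{u_2}\}=0,$$ and $$\{\hat u_i,\hat p_{u_j}\}'=\lambda_i^{-1}\delta_{ij},\qquad \{\hat u_1,\hat u_2\}'=\{\hat p_{u_1},\hat p_{u_2}\}'=0,$$ and these two brackets are compatible Poisson brackets.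
   Context: Two Poisson brackets are compatible if every linear combination of them is again a Poisson bracket. Let $(u_1,u_2,p_{u_1},p_{u_2})$ be canonical coordinates on $T^*\mathbb R^2$. The variables $\hat u_1,\hat u_2$ are the two solutions $x$ of $$\left(h_1-\left(\frac{u_1^3p_{u_1}-u_2^3p_{u_2}}{u_1-u_2}\right)^2\right)x^2-\frac{bu_1u_2+c(u_1+u_2)}{u_1^2u_2^2}\,x-\frac{c}{u_1u_2}=0,$$ $$h_1=\frac{u_1^5p_{u_1}^2}{u_1-u_2}+\frac{u_2^5p_{u_2}^2}{u_2-u_1}-\frac{a}{u_1u_2}-\frac{b(u_1+u_2)}{u_1^2u_2^2}-\frac{c(u_1^2+u_1u_2+u_2^2)}{u_1^3u_2^3},$$ and $$\hat p_{u_i}=-\hat u_i^{-4}\,Q(\hat u_i),\qquad Q(x)=x\left(\frac{(x-u_2)u_1^3p_{u_1}}{u_1-u_2}+\frac{(x-u_1)u_2^3p_{u_2}}{u_2-u_1}\right).$$ The variables $(\hat u_i,\hat p_{u_i})$ are canonical for the original canonical bracket, so the first bracket in the claim is that bracket. Everything is understood locally at generic points, where all expressions are defined ($u_1\ne u_2$, $u_1u_2\neq0$, nonzero leading coefficient, $\hat u_1,\hat u_2$ nonzero and distinct, $\lambda_i\neq0$), with smooth local branches chosen; complex values are allowed. *)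

(* Defs.v *)
From HB Require Import structures.
From mathcomp Require Import all_boot all_order all_algebra.
From mathcomp Require Import complex.
From mathcomp Require Import all_classical all_reals all_analysis.

Set Implicit Arguments.
Unset Strict Implicit.
Unset Printing Implicit Defensive.

Import Order.TTheory GRing.Theory Num.Theory.
Import numFieldNormedType.Exports.

Local Open Scope classical_set_scope.
Local Open Scope ring_scope.
Local Open Scope complex_scope.

Section SmoothFunctions.
Variables (R : realType) (m : nat).
Implicit Types (U : set 'rV[R]_m) (k : 'I_m).

Definition rpartial k (f : 'rV[R]_m -> R) : 'rV[R]_m -> R :=
  fun x => 'D_(delta_mx ord0 k) f x.

Fixpoint Cn_on (n : nat) U (f : 'rV[R]_m -> R) : Prop :=
  (forall x, U x -> {for x, continuous f}) /\
  match n with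
  | 0 => True
  | n'.+1 => forall k,
      (forall x, U x -> derivable f x (delta_mx ord0 k)) /\
      Cn_on n' U (rpartial k f)
  end.

(* Functions are total; only their restrictions to the open set U matter.
   R[i] carries no real normed-module structure, so differentiation is done
   on real and imaginary parts. *)
Definition smooth_on U (F : 'rV[R]_m -> R[i]) : Prop :=
  forall n, Cn_on n U (fun x => complex.Re (F x)) /\
            Cn_on n U (fun x => complex.Im (F x)).

Definition partial k (F : 'rV[R]_m -> R[i]) : 'rV[R]_m -> R[i] :=
  fun x => rpartial k (fun y => complex.Re (F y)) x
             +i* rpartial k (fun y => complex.Im (F y)) x.

End SmoothFunctions.

Section PoissonBrackets.
Variables (R : realType) (m : nat).
Implicit Types (U : set 'rV[R]_m) (F G H : 'rV[R]_m -> R[i]).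

Definition bracket : Type :=
  ('rV[R]_m -> R[i]) -> ('rV[R]_m -> R[i]) -> 'rV[R]_m -> R[i].

(* A Poisson bracket on the algebra of smooth complex-valued functions on U.
   The second condition says that the operation is well defined on functions
   on U. Linearity and the Leibniz rule in the second argument follow from
   skew-symmetry. *)
Definition is_Poisson U (B : bracket) : Prop :=
  [/\ forall F G, smooth_on U F -> smooth_on U G -> smooth_on U (B F G),
      forall F F' G G', smooth_on U F -> smooth_on U F' ->
        smooth_on U G -> smooth_on U G' ->
        {in U, F =1 F'} -> {in U, G =1 G'} -> {in U, B F G =1 B F' G'},
      forall F G, smooth_on U F -> smooth_on U G ->
        {in U, forall x, B F G x = - B G F x} &
   [/\ forall (s : R[i]) F G H,
        smooth_on U F -> smooth_on U G -> smooth_on U H ->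
        {in U, forall x, B (fun y => s * F y + G y) H x
                         = s * B F H x + B G H x},
      forall F G H, smooth_on U F -> smooth_on U G -> smooth_on U H ->
        {in U, forall x, B (fun y => F y * G y) H x
                         = F x * B G H x + B F H x * G x} &
      forall F G H, smooth_on U F -> smooth_on U G -> smooth_on U H ->
        {in U, forall x,
          B F (B G H) x + B G (B H F) x + B H (B F G) x = 0}]].

Definition compatible U (B B' : bracket) : Prop :=
  forall alpha beta : R[i],
    is_Poisson U (fun F G x => alpha * B F G x + beta * B' F G x).

(* A smooth bivector field, as a skew matrix P in the standard coordinates; the
   bracket it defines has {x_k, x_l} = P_kl and acts on functions by the chain
   rule. Nothing is assumed about the Jacobi identity. *)
Definition bivector_field U (P : 'rV[R]_m -> 'M[R[i]]_m) : Prop :=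
  (forall k l, smooth_on U (fun x => P x k l)) /\
  {in U, forall x, (P x)^T = - P x}.

Definition bivector_bracket (P : 'rV[R]_m -> 'M[R[i]]_m) : bracket :=
  fun F G x => \sum_(k < m) \sum_(l < m) P x k l * partial k F x * partial l G x.

End PoissonBrackets.

Section PhaseSpace.
Variable R : realType.

(* T^*R^2 with coordinates (u_1, u_2, p_{u_1}, p_{u_2}). *)
Definition phase := 'rV[R]_(2 + 2).

Implicit Types (x : phase) (i j : 'I_2) (uh : 'I_2 -> phase -> R[i]).

Definition ucoord i x : R[i] := (x ord0 (lshift 2 i))%:C.
Definition pcoord i x : R[i] := (x ord0 (rshift 2 i))%:C.

Definition canonical_bracket : bracket R (2 + 2) := fun F G x =>
  \sum_(i < 2) (partial (lshift 2 i) F x * partial (rshift 2 i) G x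
                - partial (rshift 2 i) F x * partial (lshift 2 i) G x).

(* {q_i, p_j} = s_i delta_ij, {q_i, q_j} = {p_i, p_j} = 0. *)
Definition diagonal_relations (U : set phase) (B : bracket R (2 + 2))
    (q p : 'I_2 -> phase -> R[i]) (s : 'I_2 -> phase -> R[i]) : Prop :=
  forall i j, {in U, forall x,
    [/\ B (q i) (p j) x = s i x * (i == j)%:R,
        B (q i) (q j) x = 0 &
        B (p i) (p j) x = 0]}.

Section Potential.
Variables a b c : R.

Definition h1 x : R[i] :=
  let u1 := ucoord 0 x in let u2 := ucoord 1 x in
  let p1 := pcoord 0 x in let p2 := pcoord 1 x in
  u1 ^+ 5 * p1 ^+ 2 / (u1 - u2) + u2 ^+ 5 * p2 ^+ 2 / (u2 - u1)
  - a%:C / (u1 * u2)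
  - b%:C * (u1 + u2) / (u1 ^+ 2 * u2 ^+ 2)
  - c%:C * (u1 ^+ 2 + u1 * u2 + u2 ^+ 2) / (u1 ^+ 3 * u2 ^+ 3).

Definition leading x : R[i] :=
  let u1 := ucoord 0 x in let u2 := ucoord 1 x in
  let p1 := pcoord 0 x in let p2 := pcoord 1 x in
  h1 x - ((u1 ^+ 3 * p1 - u2 ^+ 3 * p2) / (u1 - u2)) ^+ 2.

Definition quadratic x (z : R[i]) : R[i] :=
  let u1 := ucoord 0 x in let u2 := ucoord 1 x in
  leading x * z ^+ 2
  - (b%:C * u1 * u2 + c%:C * (u1 + u2)) / (u1 ^+ 2 * u2 ^+ 2) * z
  - c%:C / (u1 * u2).

Definition Qpol x (z : R[i]) : R[i] :=
  let u1 := ucoord 0 x in let u2 := ucoord 1 x in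
  let p1 := pcoord 0 x in let p2 := pcoord 1 x in
  z * ((z - u2) * u1 ^+ 3 * p1 / (u1 - u2)
       + (z - u1) * u2 ^+ 3 * p2 / (u2 - u1)).

Definition phat uh i x : R[i] := - (uh i x) ^- 4 * Qpol x (uh i x).

Definition lambda uh i x : R[i] :=
  2%:R^-1 * (uh i x ^+ 4 * phat uh i x ^+ 2 + a%:C / uh i x ^+ 2
             + b%:C / uh i x ^+ 3 + c%:C / uh i x ^+ 4).

Definition Hhat1 uh x : R[i] := lambda uh 0 x + lambda uh 1 x.
Definition Hhat2 uh x : R[i] := (lambda uh 0 x - lambda uh 1 x) ^+ 2.

(* U consists of generic points and uh_0, uh_1 are smooth branches over U of
   the two roots of the quadratic. *)
Definition generic_branches (U : set phase) uh : Prop :=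
  [/\ open U,
      {in U, forall x, [/\ ucoord 0 x != ucoord 1 x,
                           ucoord 0 x * ucoord 1 x != 0 &
                           leading x != 0]},
      (forall i, smooth_on U (uh i)),
      {in U, forall x (z : R[i]),
         quadratic x z = 0 <-> z = uh 0 x \/ z = uh 1 x} &
      {in U, forall x, uh 0 x != uh 1 x /\
         forall i, uh i x != 0 /\ lambda uh i x != 0}].

End Potential.
End PhaseSpace.

(* Main.v *)
(** Put v_i = 1/u_i and write Q(x) = x (q1 + q2 x), so that
    p_{u_i} = q2 v_i^2 + q1 v_i^3. In terms of the power sums s = v_1 + v_2 and
    t = v_1^2 + v_2^2 the symplectic form is -(dq2 /\ ds + 1/2 dq1 /\ dt).
    The hatted variables satisfy the same relations up to sign, with the same
    q1, q2, and Vieta's formulas for the quadratic give s^ = const - s and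
    t^ = const - t - (2/c) q1^2. Since dq1 /\ d(q1^2) = 0, the hatted variables
    are canonical.

    For canonical (x_i, y_i), a bracket with {x_i, y_j}' = s_i delta_ij must be
    sum_i s_i ({x_i, .} {y_i, .} - {y_i, .} {x_i, .}), where the Hamiltonian fields
    {x_i, .} and {y_i, .} commute. The Jacobi identity holds for all weights s_i
    killed by the fields with index j != i, in particular for
    s_i = alpha + beta / lambda_i, because lambda_i depends on (x_i, y_i) only. *)

(* Two difficulties shape the argument. First, the branches $\hat u_i$ are known only as roots of a
   quadratic, while their power sums are explicit functions of $s$, $t$ and $q_1$. At points with
   $v_1\ne v_2$, both nonzero, the brackets of the $v_i$ and $p_{u_i}$ are recovered from those of
   $s,t,q_1,q_2$ by inverting a $2\times2$ Vandermonde system. The six brackets of these four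
   functions are thus an equivalent form of canonicity. The hat changes all six by a common sign,
   which is absorbed by replacing $\hat p$ with $-\hat p$. Second, the brackets of the claim are
   given only by their values on four functions, with no Jacobi identity assumed. If $J$ is the
   Jacobian of $(\hat u,\hat p)$ and $\Omega$ the canonical matrix, then $J\Omega J^T=\Omega$ makes
   $J$ invertible, so the four values determine the bivector. The Jacobi identity is then proved
   once, for the whole family of weights, and both brackets and their compatibility are read off
   from it. *)
Require Import Defs.
From HB Require Import structures.
From mathcomp Require Import all_boot all_order all_algebra.
From mathcomp Require Import complex ring lra.
From mathcomp Require Import all_classical all_reals all_analysis.
Import Order.TTheory GRing.Theory Num.Theory.
Import numFieldNormedType.Exports.

Local Open Scope classical_set_scope.
Local Open Scope ring_scope.
Local Open Scope complex_scope.

Set Implicit Arguments.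
Unset Strict Implicit.

(** * Functions of class C^n on an open set *)

Section RealCn.
Variables (R : realType) (m : nat).
Implicit Types (U : set 'rV[R]_m) (f g : 'rV[R]_m -> R) (k l : 'I_m).

Lemma open_near_eq (T : Type) U (f g : 'rV[R]_m -> T) x : open U -> U x ->
  (forall y, U y -> f y = g y) -> \forall y \near x, f y = g y.
Proof. by move=> oU Ux fg; near=> y; apply: fg; near: y; exact: open_nbhs_nbhs.
Unshelve. all: by end_near. Qed.

Lemma rpartial_eq_on U f g k : open U -> (forall y, U y -> f y = g y) ->
  forall x, U x -> rpartial k f x = rpartial k g x.
Proof. by move=> oU fg x Ux; apply: near_eq_derive; exact: (open_near_eq oU Ux fg). Qed.

Lemma continuous_eq_on U f g x : open U -> (forall y, U y -> f y = g y) -> U x ->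
  {for x, continuous f} -> {for x, continuous g}.
Proof.
move=> oU fg Ux fc.
have fcx : f @ x --> f x by exact: fc.
have gfx : g @ x --> f @ x by apply: (@near_eq_cvg _ _ (nbhs x));
  exact: (open_near_eq oU Ux fg).
have : g @ x --> f x by exact: cvg_trans gfx fcx.
by rewrite (fg x Ux).
Qed.

(** Openness makes agreement on [U] an agreement of germs, so it passes to derivatives of every
    order. The closure lemmas below rest on it: the formula for the derivative of a sum, product or
    inverse is available only at points of [U]. *)
Lemma Cn_on_eq n U f g : open U -> (forall x, U x -> f x = g x) ->
  Cn_on n U f -> Cn_on n U g.
Proof.
move=> oU; elim: n f g => [|n IH] f g fg /= [fc fd].
  split=> // x Ux; exact: (continuous_eq_on oU fg Ux (fc x Ux)).
split=> [x Ux|k].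
  exact: (continuous_eq_on oU fg Ux (fc x Ux)).
have [fk fk'] := fd k; split=> [x Ux|].
  by apply: near_eq_derivable (fk x Ux); exact: (open_near_eq oU Ux fg).
by apply: IH fk'; exact: rpartial_eq_on.
Qed.

Lemma Cn_onW n U f : Cn_on n.+1 U f -> Cn_on n U f.
Proof.
elim: n f => [|n IH] f [fc fd]; split=> // k.
by have [fk fk'] := fd k; split=> //; exact: IH.
Qed.

Lemma Cn_on_continuous n U f x : Cn_on n U f -> U x -> {for x, continuous f}.
Proof. by case: n => [|n] [fc _]; exact: fc. Qed.

Lemma Cn_on_derivable n U f k x : Cn_on n.+1 U f -> U x ->
  derivable f x (delta_mx ord0 k).
Proof. by move=> [_ /(_ k)[fk _]]; exact: fk. Qed.

Lemma Cn_on_rpartial n U f k : Cn_on n.+1 U f -> Cn_on n U (rpartial k f).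
Proof. by move=> [_ /(_ k)[]]. Qed.

Lemma Cn_on_cst n U (r : R) : Cn_on n U (fun=> r).
Proof.
elim: n r => [|n IH] r; (split; first by move=> x _; exact: cst_continuous) => // k.
split=> [x _|]; first exact: derivable_cst.
have -> : rpartial k (fun=> r) = fun=> 0 :> R.
  by apply/funext => x; rewrite /rpartial derive_cst.
exact: IH.
Qed.

Lemma Cn_onD n U f g : open U -> Cn_on n U f -> Cn_on n U g ->
  Cn_on n U (fun x => f x + g x).
Proof.
move=> oU; elim: n f g => [|n IH] f g Cf Cg; (split; first by move=> x Ux;
  apply: continuousD; [exact: Cn_on_continuous Cf Ux|exact: Cn_on_continuous Cg Ux]) => // k.
have df x (Ux : U x) := Cn_on_derivable (k := k) Cf Ux.
have dg x (Ux : U x) := Cn_on_derivable (k := k) Cg Ux.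
split=> [x Ux|]; first by apply: derivableD; [exact: df|exact: dg].
apply: (@Cn_on_eq _ U (fun x => rpartial k f x + rpartial k g x)) => //.
  by move=> x Ux; rewrite /rpartial (deriveD (df x Ux) (dg x Ux)).
by apply: IH; exact: Cn_on_rpartial.
Qed.

Lemma Cn_onM n U f g : open U -> Cn_on n U f -> Cn_on n U g ->
  Cn_on n U (fun x => f x * g x).
Proof.
move=> oU; elim: n f g => [|n IH] f g Cf Cg; (split; first by move=> x Ux;
  apply: continuousM; [exact: Cn_on_continuous Cf Ux|exact: Cn_on_continuous Cg Ux]) => // k.
have df x (Ux : U x) := Cn_on_derivable (k := k) Cf Ux.
have dg x (Ux : U x) := Cn_on_derivable (k := k) Cg Ux.
split=> [x Ux|]; first by apply: derivableM; [exact: df|exact: dg].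
apply: (@Cn_on_eq _ U (fun x => f x * rpartial k g x + g x * rpartial k f x)) => //.
  by move=> x Ux; rewrite /rpartial (deriveM (df x Ux) (dg x Ux)).
by apply: Cn_onD => //; apply: IH; by [exact: Cn_onW|exact: Cn_on_rpartial].
Qed.

Lemma Cn_onN n U f : open U -> Cn_on n U f -> Cn_on n U (fun x => - f x).
Proof.
move=> oU Cf; apply: (@Cn_on_eq _ U (fun x => (-1) * f x)) => //.
  by move=> x _; rewrite mulN1r.
by apply: Cn_onM => //; exact: Cn_on_cst.
Qed.

(** The induction keeps [f] fixed: the derivative $-f^{-2}\partial_k f$ involves $1/f$ itself, and
    the induction hypothesis supplies exactly the class needed for it. *)
Lemma Cn_onV n U f : open U -> (forall x, U x -> f x != 0) -> Cn_on n U f ->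
  Cn_on n U (fun x => (f x)^-1).
Proof.
move=> oU f0; elim: n => [|n IH] Cf; (split; first by move=> x Ux;
  apply: continuousV; [exact: f0|exact: Cn_on_continuous Cf Ux]) => // k.
have df x (Ux : U x) := Cn_on_derivable (k := k) Cf Ux.
split=> [x Ux|]; first by apply: derivableV; [exact: f0|exact: df].
have CV := IH (Cn_onW Cf).
apply: (@Cn_on_eq _ U (fun x => - ((f x)^-1 * (f x)^-1 * rpartial k f x))) => //.
  move=> x Ux; rewrite /rpartial (deriveV (f0 x Ux) (df x Ux)).
  by rewrite -invfM -expr2 scaleNr.
apply: Cn_onN => //; apply: Cn_onM => //; last exact: Cn_on_rpartial.
exact: Cn_onM.
Qed.

Lemma is_derive_coord l (x v : 'rV[R]_m) :
  is_derive x v (fun y : 'rV[R]_m => y ord0 l) (v ord0 l).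
Proof.
have lin : linear (fun y : 'rV[R]_m => y ord0 l : R^o).
  by move=> r y z; rewrite !mxE.
pose h := GRing.isLinear.Build R 'rV[R]_m R^o *:%R _ lin.
pose L : {linear 'rV[R]_m -> R^o} := HB.pack (fun y : 'rV[R]_m => y ord0 l) h.
have cL : continuous L by exact: coord_continuous.
have dL : differentiable L x by exact: linear_differentiable.
split; first exact: (diff_derivable (f := L)).
by rewrite (@deriveE _ _ _ L)// (diff_lin _ cL).
Qed.

Lemma Cn_on_coord n U l : Cn_on n U (fun x => x ord0 l).
Proof.
case: n => [|n]; (split; first by move=> x _; exact: coord_continuous) => // k.
split=> [x _|].
  by have [] := is_derive_coord l x (delta_mx ord0 k).
have -> : rpartial k (fun x : 'rV[R]_m => x ord0 l)
    = fun=> (delta_mx ord0 k : 'rV[R]_m) ord0 l.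
  by apply/funext => x; have [] := is_derive_coord l x (delta_mx ord0 k).
exact: Cn_on_cst.
Qed.
End RealCn.

(** * Symmetry of second partial derivatives *)

Section Schwarz.
Variables (R : realType) (m : nat).
Implicit Types (U : set 'rV[R]_m) (f g : 'rV[R]_m -> R) (k l : 'I_m).
Local Notation e_ k := (delta_mx ord0 k : 'rV[R]_m).

Lemma is_derive_line f (y v : 'rV[R]_m) (s : R) : derivable f (y + s *: v) v ->
  is_derive s 1 (fun t : R => f (y + t *: v)) ('D_v f (y + s *: v)).
Proof.
have E : (fun h : R => h^-1 *: (((fun t : R => f (y + t *: v)) \o shift s) (h *: 1)
                              - f (y + s *: v)))
       = (fun h => h^-1 *: ((f \o shift (y + s *: v)) (h *: v) - f (y + s *: v))).
  apply/funext => h; congr (_ *: (_ - _)) => /=; congr f.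
  by rewrite [h%:A]mulr1 scalerDl addrCA.
by move=> df; split; rewrite /derivable /derive E.
Qed.

Lemma MVT_is_derive (phi dphi : R -> R) (h : R) : 0 < h ->
  (forall s, s \in `[0, h]%R -> is_derive s 1 phi (dphi s)) ->
  exists2 s, s \in `[0, h]%R & phi h - phi 0 = dphi s * h.
Proof.
move=> h0 dP.
have oc s : s \in `]0, h[%R -> s \in `[0, h]%R by exact: subset_itv_oo_cc.
have [|s sh E] := @MVT _ phi dphi 0 h h0 (fun s sh => dP s (oc s sh)).
  by apply: derivable_within_continuous => s sh; have [] := dP s sh.
by exists s; [exact: oc|rewrite E subr0].
Qed.

(** The mean value theorem is used twice: along [e_ k] for the increment of [f] in direction [e_ l],
    then along [e_ l] for [rpartial k f]. The left side is symmetric in [k] and [l], the right side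
    is not; [rpartialC] exploits this. *)
Lemma mixed_difference U f (x : 'rV[R]_m) k l (h : R) : Cn_on 2 U f -> 0 < h ->
  (forall s t, 0 <= s <= h -> 0 <= t <= h -> U (x + s *: e_ k + t *: e_ l)) ->
  exists s t, [/\ 0 <= s <= h, 0 <= t <= h &
    f (x + h *: e_ k + h *: e_ l) - f (x + h *: e_ k) - (f (x + h *: e_ l) - f x)
    = rpartial l (rpartial k f) (x + s *: e_ k + t *: e_ l) * h * h].
Proof.
move=> Cf h0 box.
have box0 s t : s \in `[0, h]%R -> t \in `[0, h]%R -> U (x + s *: e_ k + t *: e_ l).
  by rewrite !in_itv /=; exact: box.
have h_in : h \in `[0, h]%R by rewrite in_itv /= lexx ltW.
have o_in : 0 \in `[0, h]%R by rewrite in_itv /= lexx ltW.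
pose phi s := f ((x + h *: e_ l) + s *: e_ k) - f (x + s *: e_ k).
pose dphi s := rpartial k f ((x + h *: e_ l) + s *: e_ k) - rpartial k f (x + s *: e_ k).
have U1 s : s \in `[0, h]%R -> U ((x + h *: e_ l) + s *: e_ k).
  by move=> sh; rewrite addrAC; exact: box0.
have U0 s : s \in `[0, h]%R -> U (x + s *: e_ k).
  by move=> sh; rewrite -[x + _]addr0 -(scale0r (e_ l)); exact: box0.
have dphiP s : s \in `[0, h]%R -> is_derive s 1 phi (dphi s).
  move=> sh; apply: is_deriveB; apply: is_derive_line; apply: Cn_on_derivable Cf _.
  - exact: U1.
  - exact: U0.
have [s sh Es] := MVT_is_derive h0 dphiP.
pose psi t := rpartial k f ((x + s *: e_ k) + t *: e_ l).
have dpsiP t : t \in `[0, h]%R ->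
    is_derive t 1 psi (rpartial l (rpartial k f) ((x + s *: e_ k) + t *: e_ l)).
  move=> th; apply: is_derive_line; apply: Cn_on_derivable (Cn_on_rpartial k Cf) _.
  exact: box0.
have [t th Et] := MVT_is_derive h0 dpsiP.
exists s, t; move: (sh) (th); rewrite !in_itv /= => -> ->; split=> //.
move: Es Et; rewrite /phi /dphi /psi !scale0r !addr0 => Es Et.
rewrite -Et [x + s *: _ + _]addrAC -Es.
by rewrite [x + h *: e_ l + _]addrAC; ring.
Qed.

Lemma rpartialC U f k l x : open U -> Cn_on 2 U f -> U x ->
  rpartial l (rpartial k f) x = rpartial k (rpartial l f) x.
Proof.
move=> oU Cf Ux.
have : nbhs x U by exact: open_nbhs_nbhs.
move=> /nbhs_ballP[r /= r0 rU].
have ck : rpartial l (rpartial k f) @ x --> rpartial l (rpartial k f) x.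
  exact: (Cn_on_continuous (Cn_on_rpartial l (Cn_on_rpartial k Cf)) Ux).
have cl : rpartial k (rpartial l f) @ x --> rpartial k (rpartial l f) x.
  exact: (Cn_on_continuous (Cn_on_rpartial k (Cn_on_rpartial l Cf)) Ux).
apply/eqP; rewrite -subr_eq0 -normr_le0; apply/ler_addgt0Pr => e e0; rewrite add0r.
have e2 : 0 < e / 2 by rewrite divr_gt0.
have Nk : nbhs x [set y | `|rpartial l (rpartial k f) x - rpartial l (rpartial k f) y| <= e / 2].
  by apply: cvgr_dist_le ck _ e2.
move: Nk => /nbhs_ballP[r1 /= r10 H1].
have Nl : nbhs x [set y | `|rpartial k (rpartial l f) x - rpartial k (rpartial l f) y| <= e / 2].
  by apply: cvgr_dist_le cl _ e2.
move: Nl => /nbhs_ballP[r2 /= r20 H2].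
(* A square of side $h=q/N$ at $x$ stays within distance $q$, since $s|e_k|+t|e_l|\le
   h(|e_k|+|e_l|)<hN$. The summand 1 makes this strict and [N] positive. *)
pose N := 1 + `|e_ k| + `|e_ l|.
have N0 : 0 < N by rewrite /N; have := normr_ge0 (e_ k); have := normr_ge0 (e_ l); lra.
pose q := Num.min r (Num.min r1 r2).
have q0 : 0 < q by rewrite !lt_min r0 r10.
pose h := q / N.
have h0 : 0 < h by rewrite divr_gt0.
have near_x i j s t : 1 + `|e_ i| + `|e_ j| = N -> 0 <= s <= h -> 0 <= t <= h ->
    ball x q (x + s *: e_ i + t *: e_ j).
  move=> NE /andP[s0 sh] /andP[t0 th]; rewrite -ball_normE /= -addrA opprD addNKr normrN.
  apply: le_lt_trans (ler_normD _ _) _; rewrite !normrZ !ger0_norm//.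
  have -> : q = h * N by rewrite /h divfK ?gt_eqF.
  rewrite -NE.
  have := ler_wpM2r (normr_ge0 (e_ i)) sh; have := ler_wpM2r (normr_ge0 (e_ j)) th.
  by move: h0; lra.
have qr : q <= r by rewrite /q ge_min lexx.
have qr1 : q <= r1 by rewrite /q !ge_min lexx orbT.
have qr2 : q <= r2 by rewrite /q !ge_min lexx !orbT.
have N' : 1 + `|e_ l| + `|e_ k| = N by rewrite /N addrAC.
have [s1 [t1 [hs1 ht1 E1]]] := mixed_difference (k := k) (l := l) Cf h0
  (fun s t hs ht => rU _ (le_ball qr (near_x _ _ _ _ erefl hs ht))).
have [s2 [t2 [hs2 ht2 E2]]] := mixed_difference (k := l) (l := k) Cf h0
  (fun s t hs ht => rU _ (le_ball qr (near_x _ _ _ _ N' hs ht))).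
have /= B1 := H1 _ (le_ball qr1 (near_x _ _ _ _ erefl hs1 ht1)).
have /= B2 := H2 _ (le_ball qr2 (near_x _ _ _ _ N' hs2 ht2)).
set A := rpartial l _ _ in E1 B1; set B := rpartial k _ _ in E2 B2.
clearbody A B.
(* The second difference over the square is the same in both orders, so the two mixed partials
   agree, though at different points; continuity puts each within [e / 2] of its value at [x]. *)
have AB : A * h * h = B * h * h.
  rewrite -E1 -E2 [x + h *: e_ l + h *: e_ k]addrAC.
  move: (f (_ + _ + _)) (f (x + h *: e_ k)) (f (x + h *: e_ l)) (f x) => c1 c2 c3 c4.
  ring.
have hn0 : h != 0 by rewrite gt_eqF.
have {}AB := mulIf hn0 (mulIf hn0 AB).
move: B1 B2; rewrite AB => B1 B2.
move: (rpartial l _ _) (rpartial k _ _) B1 B2 => c d B1 B2.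
rewrite (_ : c - d = (c - B) - (d - B)); last by ring.
by apply: le_trans (ler_normB _ _) _; move: B1 B2; lra.
Qed.
End Schwarz.

(** * Complex-valued smooth functions *)

Section ComplexSmooth.
Variables (R : realType) (m : nat) (U : set 'rV[R]_m).
Hypothesis oU : open U.
Implicit Types (F G : 'rV[R]_m -> R[i]) (k l : 'I_m).

Lemma complexReD (z w : R[i]) : complex.Re (z + w) = complex.Re z + complex.Re w.
Proof. by case: z w => [? ?] []. Qed.
Lemma complexImD (z w : R[i]) : complex.Im (z + w) = complex.Im z + complex.Im w.
Proof. by case: z w => [? ?] []. Qed.
Lemma complexReM (z w : R[i]) : complex.Re (z * w) =
  complex.Re z * complex.Re w - complex.Im z * complex.Im w.
Proof. by case: z w => [? ?] []. Qed.
Lemma complexImM (z w : R[i]) : complex.Im (z * w) =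
  complex.Re z * complex.Im w + complex.Im z * complex.Re w.
Proof. by case: z w => [? ?] []. Qed.

Lemma smooth_on_eq F G : (forall x, U x -> F x = G x) ->
  smooth_on U F -> smooth_on U G.
Proof.
move=> FG sF n; have [Fr Fi] := sF n; split.
  by apply: Cn_on_eq Fr => // x /FG ->.
by apply: Cn_on_eq Fi => // x /FG ->.
Qed.

Lemma smooth_on_cst (z : R[i]) : smooth_on U (fun=> z).
Proof. by move=> n; split; exact: Cn_on_cst. Qed.

Lemma smooth_onD F G : smooth_on U F -> smooth_on U G ->
  smooth_on U (fun x => F x + G x).
Proof.
move=> sF sG n; have [Fr Fi] := sF n; have [Gr Gi] := sG n; split.
  rewrite (_ : (fun _ => _) = fun x => complex.Re (F x) + complex.Re (G x)).
    exact: Cn_onD.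
  by apply/funext => x; rewrite complexReD.
rewrite (_ : (fun _ => _) = fun x => complex.Im (F x) + complex.Im (G x)).
  exact: Cn_onD.
by apply/funext => x; rewrite complexImD.
Qed.

Lemma smooth_onM F G : smooth_on U F -> smooth_on U G ->
  smooth_on U (fun x => F x * G x).
Proof.
move=> sF sG n; have [Fr Fi] := sF n; have [Gr Gi] := sG n; split.
  rewrite (_ : (fun _ => _) = fun x => complex.Re (F x) * complex.Re (G x)
                                   + - (complex.Im (F x) * complex.Im (G x))).
    by apply: Cn_onD => //; [|apply: Cn_onN => //]; exact: Cn_onM.
  by apply/funext => x; rewrite complexReM.
rewrite (_ : (fun _ => _) = fun x => complex.Re (F x) * complex.Im (G x)
                                   + complex.Im (F x) * complex.Re (G x)).
  by apply: Cn_onD => //; exact: Cn_onM.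
by apply/funext => x; rewrite complexImM.
Qed.

Lemma smooth_onN F : smooth_on U F -> smooth_on U (fun x => - F x).
Proof.
move=> sF; apply: (smooth_on_eq (F := fun x => (-1) * F x)).
  by move=> x _; rewrite mulN1r.
exact: smooth_onM (smooth_on_cst _) sF.
Qed.

Lemma smooth_onB F G : smooth_on U F -> smooth_on U G ->
  smooth_on U (fun x => F x - G x).
Proof. by move=> sF sG; apply: smooth_onD => //; exact: smooth_onN. Qed.

Lemma smooth_onX n F : smooth_on U F -> smooth_on U (fun x => F x ^+ n).
Proof.
move=> sF; elim: n => [|n IH]; first exact: smooth_on_cst.
apply: (smooth_on_eq (F := fun x => F x * F x ^+ n)); last exact: smooth_onM.
by move=> x _; rewrite exprS.
Qed.

Lemma smooth_onV F : (forall x, U x -> F x != 0) -> smooth_on U F ->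
  smooth_on U (fun x => (F x)^-1).
Proof.
move=> F0 sF n; have [Fr Fi] := sF n.
(* [N] is $|F|^2$, a real function without zeros on [U], and $1/F=\bar F/|F|^2$. *)
pose N x := complex.Re (F x) * complex.Re (F x) + complex.Im (F x) * complex.Im (F x).
have CN : Cn_on n U (fun x => (N x)^-1).
  apply: Cn_onV => //.
    move=> x /F0; apply: contra; rewrite /N -!expr2 paddr_eq0 ?sqr_ge0//.
    by rewrite !sqrf_eq0 eq_complex.
  by apply: Cn_onD => //; exact: Cn_onM.
split.
  rewrite (_ : (fun _ => _) = fun x => complex.Re (F x) * (N x)^-1).
    exact: Cn_onM.
  by apply/funext => x; rewrite /N; case: (F x) => r i /=; rewrite !expr2.
rewrite (_ : (fun _ => _) = fun x => - (complex.Im (F x) * (N x)^-1)).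
  by apply: Cn_onN => //; exact: Cn_onM.
by apply/funext => x; rewrite /N; case: (F x) => r i /=; rewrite !expr2.
Qed.

Lemma smooth_on_div F G : (forall x, U x -> G x != 0) -> smooth_on U F ->
  smooth_on U G -> smooth_on U (fun x => F x / G x).
Proof. by move=> G0 sF sG; apply: smooth_onM => //; exact: smooth_onV. Qed.

Lemma smooth_on_coord l : smooth_on U (fun x => (x ord0 l)%:C).
Proof. by move=> n; split; [exact: Cn_on_coord|exact: Cn_on_cst]. Qed.

Lemma smooth_on_partial k F : smooth_on U F -> smooth_on U (partial k F).
Proof. by move=> sF n; have [Fr Fi] := sF n.+1; split; exact: Cn_on_rpartial. Qed.

Lemma smooth_on_sum (I : Type) (r : seq I) (F : I -> 'rV[R]_m -> R[i]) :
  (forall i, smooth_on U (F i)) -> smooth_on U (fun x => \sum_(i <- r) F i x).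
Proof.
move=> sF; elim: r => [|i r IH].
  by apply: smooth_on_eq (smooth_on_cst 0) => x _; rewrite big_nil.
by apply: smooth_on_eq (smooth_onD (sF i) IH) => x _; rewrite big_cons.
Qed.

Lemma smooth_on_derivable F k x : smooth_on U F -> U x ->
  derivable (fun y => complex.Re (F y)) x (delta_mx ord0 k) /\
  derivable (fun y => complex.Im (F y)) x (delta_mx ord0 k).
Proof.
move=> /(_ 1%N) [Fr Fi] Ux.
by split; [exact: Cn_on_derivable Fr Ux|exact: Cn_on_derivable Fi Ux].
Qed.

Lemma partial_eq_on F G k x : (forall y, U y -> F y = G y) -> U x ->
  partial k F x = partial k G x.
Proof.
move=> FG Ux; rewrite /partial; congr (_ +i* _).
  by apply: (rpartial_eq_on k oU _ Ux) => y /FG ->.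
by apply: (rpartial_eq_on k oU _ Ux) => y /FG ->.
Qed.

Lemma partial_cst k (z : R[i]) x : partial k (fun=> z) x = 0.
Proof. by rewrite /partial /rpartial !derive_cst. Qed.

Lemma partialD k F G x : smooth_on U F -> smooth_on U G -> U x ->
  partial k (fun y => F y + G y) x = partial k F x + partial k G x.
Proof.
move=> /(smooth_on_derivable k) dF /(smooth_on_derivable k) dG Ux.
have [Fr Fi] := dF x Ux; have [Gr Gi] := dG x Ux.
rewrite /partial /rpartial.
rewrite (_ : (fun y => complex.Re (F y + G y)) =
             (fun y => complex.Re (F y)) + (fun y => complex.Re (G y))); last first.
  by apply/funext => y; rewrite complexReD.
rewrite (_ : (fun y => complex.Im (F y + G y)) =
             (fun y => complex.Im (F y)) + (fun y => complex.Im (G y))); last first.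
  by apply/funext => y; rewrite complexImD.
by rewrite (deriveD Fr Gr) (deriveD Fi Gi).
Qed.

Lemma partialM k F G x : smooth_on U F -> smooth_on U G -> U x ->
  partial k (fun y => F y * G y) x = F x * partial k G x + partial k F x * G x.
Proof.
move=> /(smooth_on_derivable k) dF /(smooth_on_derivable k) dG Ux.
have [Fr Fi] := dF x Ux; have [Gr Gi] := dG x Ux.
rewrite /partial /rpartial.
rewrite (_ : (fun y => complex.Re (F y * G y)) =
   ((fun y => complex.Re (F y)) * (fun y => complex.Re (G y)) : 'rV[R]_m -> R)
   - ((fun y => complex.Im (F y)) * (fun y => complex.Im (G y)) : 'rV[R]_m -> R)); last first.
  by apply/funext => y; rewrite complexReM.
rewrite (_ : (fun y => complex.Im (F y * G y)) =
   ((fun y => complex.Re (F y)) * (fun y => complex.Im (G y)) : 'rV[R]_m -> R)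
   + ((fun y => complex.Im (F y)) * (fun y => complex.Re (G y)) : 'rV[R]_m -> R)); last first.
  by apply/funext => y; rewrite complexImM.
rewrite (deriveB (derivableM Fr Gr) (derivableM Fi Gi)).
rewrite (deriveD (derivableM Fr Gi) (derivableM Fi Gr)).
rewrite (deriveM Fr Gr) (deriveM Fi Gi) (deriveM Fr Gi) (deriveM Fi Gr).
move: ('D_ _ (fun y => complex.Re (F y)) x) ('D_ _ (fun y => complex.Im (F y)) x)
  ('D_ _ (fun y => complex.Re (G y)) x) ('D_ _ (fun y => complex.Im (G y)) x).
case: (F x) => a b; case: (G x) => c d fr fi gr gi.
by apply/eqP; rewrite eq_complex; apply/andP; split; apply/eqP => /=;
  rewrite /GRing.scale /=; ring.
Qed.

Lemma partialC k l F x : smooth_on U F -> U x ->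
  partial l (partial k F) x = partial k (partial l F) x.
Proof.
move=> /(_ 2%N) [Fr Fi] Ux.
exact: (congr2 (@Complex R) (@rpartialC R m U _ k l x oU Fr Ux)
  (@rpartialC R m U _ k l x oU Fi Ux)).
Qed.

Lemma partial_coord k l (x : 'rV[R]_m) :
  partial k (fun y : 'rV[R]_m => (y ord0 l)%:C) x = (k == l)%:R.
Proof.
rewrite /partial /rpartial /= derive_cst.
have -> : 'D_(delta_mx ord0 k) (fun y : 'rV[R]_m => y ord0 l) x = (k == l)%:R.
  by have [_ ->] := is_derive_coord l x (delta_mx ord0 k); rewrite mxE eqxx eq_sym.
by case: (k == l).
Qed.
End ComplexSmooth.

(** * Derivations and frame brackets *)

Section Derivations.
Variables (R : realType) (m : nat) (U : set 'rV[R]_m).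
Hypothesis oU : open U.
Local Notation fct := ('rV[R]_m -> R[i]).
Local Notation smooth := (smooth_on U).
Implicit Types (F G H : fct) (D : fct -> fct).

(** A derivation on total functions of which only the restriction to [U] matters: [vf_eq] stands for
    that restriction, and [vf_cst] with the Leibniz rule gives homogeneity over complex scalars.
    Coordinate fields and Hamiltonian fields are then treated alike. *)
Record vector_field D : Prop := VectorField {
  vf_smooth : forall F, smooth F -> smooth (D F);
  vf_eq : forall F G, (forall x, U x -> F x = G x) -> forall x, U x -> D F x = D G x;
  vf_cst : forall z x, U x -> D (fun=> z) x = 0;
  vfD : forall F G, smooth F -> smooth G -> forall x, U x ->
    D (fun y => F y + G y) x = D F x + D G x;
  vfM : forall F G, smooth F -> smooth G -> forall x, U x ->
    D (fun y => F y * G y) x = F x * D G x + D F x * G x }.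

Lemma vf_partial k : vector_field (partial k).
Proof.
split=> [F|F G FG x|z x _|F G sF sG x Ux|F G sF sG x Ux].
- exact: smooth_on_partial.
- exact: partial_eq_on.
- exact: partial_cst.
- exact: (partialD k sF sG).
- exact: (partialM k sF sG).
Qed.

Lemma vf_scale (a : fct) D : smooth a -> vector_field D ->
  vector_field (fun F x => a x * D F x).
Proof.
move=> sa [s e c d p]; split=> [F sF|F G FG x Ux|z x Ux|F G sF sG x Ux|F G sF sG x Ux].
- by apply: smooth_onM => //; exact: s.
- by rewrite (e _ _ FG).
- by rewrite c// mulr0.
- by rewrite d// mulrDr.
- by rewrite p// mulrDr mulrCA -[_ * _ * G x]mulrA.
Qed.

Lemma vf_sum (I : Type) (r : seq I) (D : I -> fct -> fct) :
  (forall i, vector_field (D i)) -> vector_field (fun F x => \sum_(i <- r) D i F x).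
Proof.
move=> vD; split=> [F sF|F G FG x Ux|z x Ux|F G sF sG x Ux|F G sF sG x Ux].
- by apply: smooth_on_sum => // i; exact: vf_smooth.
- by apply: eq_bigr => i _; by rewrite (vf_eq (vD i) FG).
- by rewrite big1// => i _; by rewrite (vf_cst (vD i)).
- by rewrite -big_split /=; apply: eq_bigr => i _; rewrite (vfD (vD i)).
- by rewrite mulr_sumr mulr_suml -big_split /=; apply: eq_bigr => i _; rewrite (vfM (vD i)).
Qed.

Section OneField.
Variable D : fct -> fct.
Hypothesis vD : vector_field D.

Lemma vfZ z F x : smooth F -> U x -> D (fun y => z * F y) x = z * D F x.
Proof.
move=> sF Ux; rewrite (vfM vD)//; first by rewrite (vf_cst vD)// mul0r addr0.
exact: smooth_on_cst.
Qed.

Lemma vfN F x : smooth F -> U x -> D (fun y => - F y) x = - D F x.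
Proof.
move=> sF Ux; rewrite -mulN1r -vfZ//; apply: (vf_eq vD) => // y _.
by rewrite mulN1r.
Qed.

Lemma vfB F G x : smooth F -> smooth G -> U x ->
  D (fun y => F y - G y) x = D F x - D G x.
Proof.
by move=> sF sG Ux; rewrite (vfD vD)// ?vfN//; exact: smooth_onN.
Qed.

Lemma vfX n F x : smooth F -> U x ->
  D (fun y => F y ^+ n) x = n%:R * F x ^+ n.-1 * D F x.
Proof.
move=> sF Ux; elim: n => [|n IH].
  rewrite !mul0r -(vf_cst vD 1 Ux); exact: (vf_eq vD).
rewrite (@vf_eq _ vD _ (fun y => F y * F y ^+ n)) => [|y _|//]; last by rewrite exprS.
rewrite (vfM vD)//; last exact: smooth_onX.
rewrite IH; move: (F x) (D F x) => a d.
by case: n {IH} => [|n] /=; rewrite ?exprS -?[n.+2]addn1 ?natrD; ring.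
Qed.

Lemma vfV F x : smooth F -> (forall y, U y -> F y != 0) -> U x ->
  D (fun y => (F y)^-1) x = - D F x / F x ^+ 2.
Proof.
move=> sF F0 Ux; have sV := smooth_onV oU F0 sF.
have : D (fun y => F y * (F y)^-1) x = 0.
  by rewrite -(vf_cst vD 1 Ux); apply: (vf_eq vD) => // y /F0 /divff.
rewrite (vfM vD)// => E; apply: (mulfI (F0 x Ux)).
move/eqP: E; rewrite addr_eq0 => /eqP ->.
by field; exact: F0.
Qed.
End OneField.

Section Frame.
Variables (X Y : 'I_2 -> fct -> fct).
Hypotheses (vX : forall i, vector_field (X i)) (vY : forall i, vector_field (Y i)).

(** The bracket of the bivector $\sum_i w_iX_i\wedge Y_i$. The fields stay abstract because both the
    coordinate fields and the Hamiltonian fields of the hatted variables are used. *)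
Definition frame_bracket (w : 'I_2 -> fct) : bracket R m :=
  fun F G x => \sum_(i < 2) w i x * (X i F x * Y i G x - Y i F x * X i G x).

Lemma frame_smooth w F G : (forall i, smooth (w i)) -> smooth F -> smooth G ->
  smooth (frame_bracket w F G).
Proof.
move=> sw sF sG; apply: smooth_on_sum => // i; apply: smooth_onM => //.
by apply: smooth_onB => //; apply: smooth_onM => //; apply: vf_smooth.
Qed.

Lemma vf_frame w D F G x : vector_field D -> (forall i, smooth (w i)) ->
  smooth F -> smooth G -> U x ->
  D (frame_bracket w F G) x =
  \sum_(i < 2) (D (w i) x * (X i F x * Y i G x - Y i F x * X i G x)
    + w i x * (D (X i F) x * Y i G x + X i F x * D (Y i G) x
               - D (Y i F) x * X i G x - Y i F x * D (X i G) x)).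
Proof.
move=> vD sw sF sG Ux.
have sXF i := vf_smooth (vX i) sF; have sXG i := vf_smooth (vX i) sG.
have sYF i := vf_smooth (vY i) sF; have sYG i := vf_smooth (vY i) sG.
pose T i := fun y => X i F y * Y i G y - Y i F y * X i G y.
have sT i : smooth (T i) by apply: smooth_onB => //; exact: smooth_onM.
rewrite (@vf_eq _ vD _ (fun y => w ord0 y * T ord0 y + w ord_max y * T ord_max y)); last 2 first.
- move=> y _; rewrite /frame_bracket !big_ord_recl big_ord0 addr0.
  by rewrite (_ : lift _ _ = ord_max)//; apply: val_inj.
- exact: Ux.
rewrite (vfD vD) //; do ?exact: smooth_onM.
rewrite !big_ord_recl big_ord0 addr0 (_ : lift _ _ = ord_max); last exact: val_inj.
rewrite !(vfM vD)// !(vfB vD)//; do ?exact: smooth_onM.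
rewrite !(vfM vD)// /T.
congr (_ + _); rewrite [w _ _ * _ + _]addrC; congr (_ + _ * _);
  rewrite [X in _ - X]addrC opprD addrA; congr (_ - _ - _); exact: addrC.
Qed.
End Frame.
End Derivations.

(** * Pointwise algebra of the Jacobi identity *)

Section JacobiAlgebra.
Variable C : comNzRingType.
Implicit Types (w f g h : nat -> C) (dw ff gg hh : nat -> nat -> C).

(* [f a] and [ff a b] stand for [D_a F] and [D_a (D_b F)], where
   [D_0, D_1, D_2, D_3] are the frame fields [X_0, X_1, Y_0, Y_1]. *)
Definition frame_jet w f g : C :=
  w 0%N * (f 0%N * g 2%N - f 2%N * g 0%N) + w 1%N * (f 1%N * g 3%N - f 3%N * g 1%N).

Definition dframe_term (dwi wi fx fy gx gy dfx dfy dgx dgy : C) : C :=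
  dwi * (fx * gy - fy * gx) + wi * (dfx * gy + fx * dgy - dfy * gx - fy * dgx).

Definition dframe_jet w dw f ff g gg (a : nat) : C :=
  dframe_term (dw a 0%N) (w 0%N) (f 0%N) (f 2%N) (g 0%N) (g 2%N)
    (ff a 0%N) (ff a 2%N) (gg a 0%N) (gg a 2%N)
  + dframe_term (dw a 1%N) (w 1%N) (f 1%N) (f 3%N) (g 1%N) (g 3%N)
    (ff a 1%N) (ff a 3%N) (gg a 1%N) (gg a 3%N).

(** Second derivatives cancel in pairs because the fields commute. By the four vanishing conditions
    a derivative of $w_i$ survives only along the fields of index $i$. It then multiplies the cyclic
    sum of $f\,(g\wedge h)$ for three vectors $f,g,h$ in the plane of $X_i,Y_i$, and this sum is
    zero. *)
Lemma frame_jet_jacobi w dw f ff g gg h hh :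
  dw 0%N 1%N = 0 -> dw 2%N 1%N = 0 -> dw 1%N 0%N = 0 -> dw 3%N 0%N = 0 ->
  (forall a b, ff a b = ff b a) -> (forall a b, gg a b = gg b a) ->
  (forall a b, hh a b = hh b a) ->
  frame_jet w f (dframe_jet w dw g gg h hh) + frame_jet w g (dframe_jet w dw h hh f ff)
  + frame_jet w h (dframe_jet w dw f ff g gg) = 0.
Proof.
move=> w01 w21 w10 w30 fC gC hC.
rewrite /frame_jet /dframe_jet /dframe_term w01 w21 w10 w30.
rewrite !(fC 1%N 0%N) !(fC 2%N 0%N) !(fC 3%N 0%N) !(fC 2%N 1%N) !(fC 3%N 1%N) !(fC 3%N 2%N).
rewrite !(gC 1%N 0%N) !(gC 2%N 0%N) !(gC 3%N 0%N) !(gC 2%N 1%N) !(gC 3%N 1%N) !(gC 3%N 2%N).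
rewrite !(hC 1%N 0%N) !(hC 2%N 0%N) !(hC 3%N 0%N) !(hC 2%N 1%N) !(hC 3%N 1%N) !(hC 3%N 2%N).
ring.
Qed.
End JacobiAlgebra.

Section FramePoisson.
Variables (R : realType) (m : nat) (U : set 'rV[R]_m).
Hypothesis oU : open U.
Local Notation fct := ('rV[R]_m -> R[i]).
Local Notation smooth := (smooth_on U).
Implicit Types (F G H : fct) (D : fct -> fct).

Lemma is_Poisson_ext (B B' : bracket R m) :
  (forall F G, smooth F -> smooth G -> forall x, U x -> B F G x = B' F G x) ->
  is_Poisson U B -> is_Poisson U B'.
Proof.
move=> BB' [Bs Be Bn [Bl Bm Bj]]; split.
- by move=> F G sF sG; apply: (smooth_on_eq oU (BB' F G sF sG)); exact: Bs.
- move=> F F' G G' sF sF' sG sG' EF EG x xU.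
  have Ux := set_mem xU.
  by rewrite -!BB'//; exact: (Be F F' G G').
- by move=> F G sF sG x xU; have Ux := set_mem xU; rewrite -!BB'//; exact: Bn.
- split=> [s||] F G H sF sG sH x xU; have Ux := set_mem xU.
  + rewrite -!BB'//; first exact: Bl.
    by apply: smooth_onD => //; apply: smooth_onM => //; exact: smooth_on_cst.
  + by rewrite -!BB'//; [exact: Bm|exact: smooth_onM].
  (* The inner brackets agree on [U] only, so replacing one inside the outer bracket needs the
     clause that [B] is well defined on functions on [U]. *)
  + have E F1 F2 F3 : smooth F1 -> smooth F2 -> smooth F3 ->
       B' F1 (B' F2 F3) x = B F1 (B F2 F3) x.
      move=> s1 s2 s3; have s23 := Bs _ _ s2 s3.
      have s23' : smooth (B' F2 F3) by exact: (smooth_on_eq oU (BB' F2 F3 s2 s3)).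
      rewrite -BB'//; apply: Be => // y yU; have Uy := set_mem yU.
      by rewrite BB'.
    by rewrite !E//; exact: Bj.
Qed.

Variables (X Y : 'I_2 -> fct -> fct).
Hypotheses (vX : forall i, vector_field U (X i)) (vY : forall i, vector_field U (Y i)).
Hypothesis XXC : forall i j F x, smooth F -> U x -> X i (X j F) x = X j (X i F) x.
Hypothesis YYC : forall i j F x, smooth F -> U x -> Y i (Y j F) x = Y j (Y i F) x.
Hypothesis XYC : forall i j F x, smooth F -> U x -> X i (Y j F) x = Y j (X i F) x.

(** The default of [nth] is the fourth field, at index 3. It also serves every larger index, so that
    commutation holds for all natural indices, as [frame_jet_jacobi] requires. *)
Let D (a : nat) : fct -> fct := nth (Y ord_max) [:: X ord0; X ord_max; Y ord0] a.

Let DC a b F x : smooth F -> U x -> D a (D b F) x = D b (D a F) x.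
Proof.
move=> sF Ux; rewrite /D.
case: a => [|[|[|a]]]; case: b => [|[|[|b]]] /=; rewrite ?nth_nil;
  by [exact: XXC|exact: YYC|exact: XYC|rewrite XYC].
Qed.

Variable w : 'I_2 -> fct.
Hypothesis sw : forall i, smooth (w i).
Hypothesis wX : forall i j x, U x -> i != j -> X i (w j) x = 0.
Hypothesis wY : forall i j x, U x -> i != j -> Y i (w j) x = 0.

Lemma frame_Poisson : is_Poisson U (frame_bracket X Y w).
Proof.
have lift0 : lift ord0 ord0 = ord_max :> 'I_2 by exact: val_inj.
split.
- by move=> F G; exact: frame_smooth.
- move=> F F' G G' sF sF' sG sG' EF EG x xU; have Ux := set_mem xU.
  apply: eq_bigr => i _; congr (_ * (_ * _ - _ * _)).
  + by apply: (vf_eq (vX i)) Ux => y Uy; apply: EF; exact: mem_set.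
  + by apply: (vf_eq (vY i)) Ux => y Uy; apply: EG; exact: mem_set.
  + by apply: (vf_eq (vY i)) Ux => y Uy; apply: EF; exact: mem_set.
  + by apply: (vf_eq (vX i)) Ux => y Uy; apply: EG; exact: mem_set.
- move=> F G sF sG x xU; rewrite -sumrN; apply: eq_bigr => i _.
  by rewrite -[RHS]mulrN opprB [X i F x * _]mulrC [Y i F x * _]mulrC.
- split=> [s||] F G H sF sG sH x xU; have Ux := set_mem xU.
  + rewrite mulr_sumr -big_split; apply: eq_bigr => i _ /=.
    have ssF : smooth (fun y => s * F y) by apply: smooth_onM => //; exact: smooth_on_cst.
    rewrite (vfD (vX i) ssF sG Ux) (vfD (vY i) ssF sG Ux).
    rewrite (vfZ (vX i) s sF Ux) (vfZ (vY i) s sF Ux).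
    by move: (X i F x) (Y i F x) (X i G x) (Y i G x) (X i H x) (Y i H x) (w i x) => *; ring.
  + rewrite mulr_sumr mulr_suml -big_split; apply: eq_bigr => i _ /=.
    rewrite (vfM (vX i) sF sG Ux) (vfM (vY i) sF sG Ux).
    by move: (X i F x) (Y i F x) (X i G x) (Y i G x) (X i H x) (Y i H x) (w i x)
      (F x) (G x) => *; ring.
  + pose jw a := nth (w ord_max x) [:: w ord0 x] a.
    pose jdw a b := D a (if b is 0%N then w ord0 else w ord_max) x.
    pose j1 K a := D a K x; pose j2 K a b := D a (D b K) x.
    have E F1 F2 F3 : smooth F1 -> smooth F2 -> smooth F3 ->
        frame_bracket X Y w F1 (frame_bracket X Y w F2 F3) x
      = frame_jet jw (j1 F1) (dframe_jet jw jdw (j1 F2) (j2 F2) (j1 F3) (j2 F3)).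
      move=> s1 s2 s3; rewrite {1}/frame_bracket.
      rewrite !big_ord_recl big_ord0 addr0 lift0.
      rewrite !(vf_frame oU vX vY (vX _) sw s2 s3 Ux) !(vf_frame oU vX vY (vY _) sw s2 s3 Ux).
      by rewrite !big_ord_recl !big_ord0 !addr0 lift0.
    rewrite !E//; apply: frame_jet_jacobi; rewrite /jdw /D /=;
      do ?[exact: wX|exact: wY]; by move=> a b; exact: DC.
Qed.
End FramePoisson.

(** * Bivectors and the canonical bracket *)

Section SymplecticMatrix.
Variable C : comNzRingType.

(** The matrix of brackets of $(q,p)$ with $\{q_i,p_j\}=A_{ij}$. Its lower block is $-A$ and not
    $-A^T$; for the identity and the diagonal weights used here the two coincide. *)
Definition symplectic_mx n (A : 'M[C]_n) : 'M[C]_(n + n) := block_mx 0 A (- A) 0.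

Lemma symplectic_sqr n : symplectic_mx (1%:M : 'M[C]_n) *m symplectic_mx 1%:M = - 1%:M.
Proof.
rewrite /symplectic_mx mulmx_block !mul0mx !mulmx0 mul1mx mulmx1 !add0r !addr0.
by rewrite -[RHS]/(- 1%:M) scalar_mx_block opp_block_mx !oppr0.
Qed.

Lemma diag_pairing n (a b d : 'I_n -> C) :
  ((\row_i a i) *m diag_mx (\row_i d i) *m (\row_i b i)^T) ord0 ord0
  = \sum_i d i * (a i * b i).
Proof.
rewrite mul_mx_diag mxE; apply: eq_bigr => i _.
by rewrite !mxE mulrAC mulrC.
Qed.
End SymplecticMatrix.

Section SymplecticTransport.
Variables (C : fieldType) (n : nat) (J P : 'M[C]_(n + n)).
Local Notation Om := (symplectic_mx (1%:M : 'M[C]_n)).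

(** From $J\Omega J^T=\Omega$ and $\Omega^2=-1$ the inverse of $J$ is $K=-\Omega J^T\Omega$. Hence
    $P$ is recovered from $JPJ^T$, and the components $gK$ of a covector in the frame are, up to
    order and sign, its canonical pairings $g\Omega J^T$ with the frame. *)
Lemma symplectic_transport (A : 'M[C]_n) (g h : 'rV[C]_(n + n)) (g1 g2 h1 h2 : 'rV[C]_n) :
  J *m Om *m J^T = Om -> J *m P *m J^T = symplectic_mx A ->
  g *m Om *m J^T = row_mx g1 g2 -> h *m Om *m J^T = row_mx h1 h2 ->
  g *m P *m h^T = g1 *m A *m h2^T - g2 *m A *m h1^T.
Proof.
move=> JOm JP gE hE; pose K := - (Om *m J^T *m Om).
have KJ : K *m J = 1%:M.
  apply: mulmx1C; rewrite /K mulmxN !mulmxA JOm symplectic_sqr opprK//.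
have coordE (f : 'rV[C]_(n + n)) f1 f2 : f *m Om *m J^T = row_mx f1 f2 ->
    f *m K = row_mx f2 (- f1).
  move=> fE; rewrite /K mulmxN !mulmxA fE /symplectic_mx mul_row_block.
  by rewrite !mulmx0 mulmxN !mulmx1 add0r addr0 opp_row_mx opprK.
have -> : g *m P *m h^T = (g *m K) *m (J *m P *m J^T) *m (h *m K)^T.
  rewrite trmx_mul !mulmxA -[g *m K *m J]mulmxA KJ mulmx1.
  by rewrite -[_ *m J^T *m _]mulmxA -trmx_mul KJ trmx1 mulmx1.
rewrite (coordE _ _ _ gE) (coordE _ _ _ hE) JP /symplectic_mx mul_row_block.
rewrite tr_row_mx mul_row_col !mulmx0 add0r addr0 mulmxN !mulNmx opprK.
by rewrite [(- h1)^T]linearN mulmxN.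
Qed.

(** The minus signs fit the use: [g *m Om *m J^T] lists brackets with the frame function in second
    place, whereas the Hamiltonian fields of the frame put it first. The signs cancel in the
    result. *)
Lemma symplectic_transport_diag (g h : 'rV[C]_(n + n)) (g1 g2 h1 h2 d : 'I_n -> C) :
  J *m Om *m J^T = Om -> J *m P *m J^T = symplectic_mx (diag_mx (\row_i d i)) ->
  g *m Om *m J^T = row_mx (\row_i - g1 i) (\row_i - g2 i) ->
  h *m Om *m J^T = row_mx (\row_i - h1 i) (\row_i - h2 i) ->
  (g *m P *m h^T) ord0 ord0 = \sum_i d i * (g1 i * h2 i - g2 i * h1 i).
Proof.
move=> JOm JP gE hE; rewrite (symplectic_transport JOm JP gE hE).
rewrite [LHS]mxE [X in _ + X]mxE !diag_pairing -sumrB.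
by apply: eq_bigr => i _; rewrite -mulrBr !mulrNN.
Qed.
End SymplecticTransport.

(** * Brackets on phase space and their determination by a frame *)

Section PhaseBrackets.
Variable R : realType.
Implicit Types (U : set (phase R)) (P : phase R -> 'M[R[i]]_(2 + 2)) (F G : phase R -> R[i]).

Definition gradient F (x : phase R) : 'rV[R[i]]_(2 + 2) := \row_k partial k F x.

Lemma bivector_bracketE P F G x :
  bivector_bracket P F G x = (gradient F x *m P x *m (gradient G x)^T) ord0 ord0.
Proof.
rewrite mxE /bivector_bracket exchange_big; apply: eq_bigr => l _.
rewrite !mxE mulr_suml; apply: eq_bigr => k _.
by rewrite !mxE [P x k l * _]mulrC.
Qed.

Definition canonical_mx : phase R -> 'M[R[i]]_(2 + 2) := fun=> symplectic_mx 1%:M.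

Lemma canonical_bracketE F G x :
  canonical_bracket F G x = bivector_bracket canonical_mx F G x.
Proof.
rewrite bivector_bracketE /canonical_mx /symplectic_mx.
rewrite -[gradient F x]hsubmxK -[gradient G x]hsubmxK.
rewrite mul_row_block tr_row_mx mul_row_col !mulmx0 add0r addr0 mulmxN !mulmx1 mulNmx.
rewrite [_ ord0 ord0]mxE [X in _ + X]mxE !mxE /canonical_bracket.
rewrite sumrB [RHS]addrC; congr (_ + _); last first.
  by congr (- _); apply: eq_bigr => i _; rewrite !mxE.
by apply: eq_bigr => i _; rewrite !mxE.
Qed.

Lemma bivector_vf U P F : open U -> (forall k l, smooth_on U (fun x => P x k l)) ->
  smooth_on U F -> vector_field U (bivector_bracket P F).
Proof.
move=> oU sP sF; apply: (vf_sum oU) => k; apply: (vf_sum oU) => l.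
apply: (vf_scale oU); last exact: vf_partial.
by apply: smooth_onM => //; exact: smooth_on_partial.
Qed.

Lemma canonical_mx_smooth U k l : smooth_on U (fun x : phase R => canonical_mx x k l).
Proof. exact: smooth_on_cst. Qed.

Lemma canonical_bivector_field U : bivector_field U canonical_mx.
Proof.
split=> [k l|x _]; first exact: canonical_mx_smooth.
by rewrite /canonical_mx /symplectic_mx tr_block_mx opp_block_mx !trmx0 linearN /=
  trmx1 oppr0 opprK.
Qed.

Lemma bivector_bracketC U P F G x : bivector_field U P -> U x ->
  bivector_bracket P F G x = - bivector_bracket P G F x.
Proof.
move=> [_ Pskew] Ux; rewrite !bivector_bracketE.
rewrite -[in LHS](trmxK (_ *m _ *m _)) [in LHS]mxE.
by rewrite !trmx_mul trmxK (Pskew x (mem_set Ux)) mulNmx mulmxN mxE mulmxA.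
Qed.

(** A frame bracket with weights 1; its coordinate fields commute by Schwarz. The Jacobi identity
    obtained here is in turn what makes the Hamiltonian fields of the hatted variables commute. *)
Lemma canonical_Poisson U : open U -> is_Poisson U (bivector_bracket canonical_mx).
Proof.
move=> oU.
apply: (@is_Poisson_ext _ _ _ oU
  (frame_bracket (fun i => partial (lshift 2 i)) (fun i => partial (rshift 2 i))
    (fun _ _ => 1))).
  move=> F G _ _ x _; rewrite -canonical_bracketE.
  by apply: eq_bigr => i _; rewrite mul1r.
apply: (frame_Poisson oU).
- by move=> i; exact: vf_partial.
- by move=> i; exact: vf_partial.
- by move=> i j F x sF Ux; exact: (partialC oU _ _ sF Ux).
- by move=> i j F x sF Ux; exact: (partialC oU _ _ sF Ux).
- by move=> i j F x sF Ux; exact: (partialC oU _ _ sF Ux).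
- by move=> i; exact: smooth_on_cst.
- by move=> *; exact: partial_cst.
- by move=> *; exact: partial_cst.
Qed.

(** The Jacobi identity says that the commutator of the fields of $f$ and $g$ is the field of
    $\{f,g\}$, and a constant has zero field. *)
Lemma hamiltonian_commute U P f g z F x : open U -> bivector_field U P ->
  is_Poisson U (bivector_bracket P) -> smooth_on U f -> smooth_on U g ->
  smooth_on U F -> (forall y, U y -> bivector_bracket P f g y = z) -> U x ->
  bivector_bracket P f (bivector_bracket P g F) x
  = bivector_bracket P g (bivector_bracket P f F) x.
Proof.
set B := bivector_bracket P.
move=> oU bP PB sf sg sF fgz Ux.
have [Bs _ _ [_ _ Bj]] := PB.
have vB K : smooth_on U K -> vector_field U (B K) by apply: bivector_vf => //; case: bP.
have := Bj f g F sf sg sF x (mem_set Ux).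
rewrite -/B (vf_eq (vB F sF) fgz Ux) (vf_cst (vB F sF) z Ux) addr0.
have E y : U y -> B F f y = - B f F y by move=> Uy; exact: bivector_bracketC bP Uy.
rewrite (vf_eq (vB g sg) E Ux) (vfN (vB g sg) (Bs f F sf sF) Ux).
by move/subr0_eq.
Qed.

Definition frame_fun (q p : 'I_2 -> phase R -> R[i]) (a : 'I_(2 + 2)) :=
  match fintype.split a with inl i => q i | inr i => p i end.

Definition frame_jacobian q p x : 'M[R[i]]_(2 + 2) :=
  \matrix_(a, k) partial k (frame_fun q p a) x.

Lemma diagonal_relations_bracket (U : set (phase R)) P q p s x :
  bivector_field U P -> diagonal_relations U (bivector_bracket P) q p s -> U x ->
  frame_jacobian q p x *m P x *m (frame_jacobian q p x)^T
  = symplectic_mx (diag_mx (\row_i s i x)).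
Proof.
move=> bP rel Ux; set f := frame_fun q p; set J := frame_jacobian q p x.
have xU := mem_set Ux.
have rowJ a : row a J = gradient (f a) x by apply/rowP => k; rewrite !mxE.
have E a b : (J *m P x *m J^T) a b = bivector_bracket P (f a) (f b) x.
  rewrite bivector_bracketE -!rowJ tr_row -!row_mul.
  by rewrite [LHS]mxE [RHS]mxE [RHS]mxE; apply: eq_bigr => k _; rewrite [col _ _ _ _]mxE.
apply/matrixP => a b; rewrite E /symplectic_mx !mxE /f /frame_fun.
case: (fintype.split a) => i; rewrite mxE; case: (fintype.split b) => j;
  have [r1 r2 r3] := rel i j x xU.
- by rewrite r2 mxE.
- by rewrite r1 !mxE mulr_natr.
- have [r1' _ _] := rel j i x xU.
  rewrite (bivector_bracketC _ _ bP Ux) r1' !mxE eq_sym.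
  by case: eqP => [->|]; rewrite ?mulr1 ?mulr0.
- by rewrite r3 mxE.
Qed.

(** Uniqueness: the differentials of [q] and [p] form a basis, so a bivector is fixed by their
    mutual brackets. The canonical structure enters only to produce the dual fields, as Hamiltonian
    fields. The Jacobi identity for [P] is not assumed, so it can be deduced from this formula. *)
Lemma bivector_bracket_frame U P q p s F G x :
  bivector_field U P -> diagonal_relations U (bivector_bracket P) q p s ->
  diagonal_relations U (bivector_bracket canonical_mx) q p (fun _ _ => 1) -> U x ->
  let B := bivector_bracket canonical_mx in
  bivector_bracket P F G x
  = frame_bracket (fun i => B (q i)) (fun i => B (p i)) s F G x.
Proof.
move=> bP relP relO Ux B.
have JP := diagonal_relations_bracket bP relP Ux.
have JO := diagonal_relations_bracket (canonical_bivector_field U) relO Ux.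
move: JP JO; set J := frame_jacobian q p x => JP JO.
have Jf K : gradient K x *m symplectic_mx 1%:M *m J^T
   = row_mx (\row_i - B (q i) K x) (\row_i - B (p i) K x).
  apply/rowP => a; rewrite !mxE.
  have bC f : - B f K x = B K f x.
    by rewrite [RHS](bivector_bracketC _ _ (canonical_bivector_field U) Ux).
  transitivity (B K (frame_fun q p a) x).
    by rewrite /B bivector_bracketE mxE; apply: eq_bigr => k _; rewrite !mxE.
  by rewrite /frame_fun; case: (fintype.split a) => i; rewrite mxE bC.
have JO1 : J *m symplectic_mx 1%:M *m J^T = symplectic_mx 1%:M.
  rewrite -[symplectic_mx 1%:M in LHS]/(canonical_mx x) JO; congr symplectic_mx.
  by apply/matrixP => i j; rewrite !mxE.
by rewrite bivector_bracketE (symplectic_transport_diag JO1 JP (Jf F) (Jf G)).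
Qed.
End PhaseBrackets.

(** * Canonicity of the hatted variables *)

Section CubicAlgebra.
Variable K : fieldType.

(** Division by $v_i^2$ leaves the linear function $A+Bv$ with values $-r_i$ at $v_i$. Below, $A$
    and $B$ are brackets of one $v_i$ with $q_2$ and $q_1$, and $(r_0,r_1)$ is $(e,0)$ or
    $(0,e)$. *)
Lemma cubic_solve (v0 v1 A B r0 r1 : K) : v0 != 0 -> v1 != 0 -> v0 != v1 ->
  A * v0 ^+ 2 + B * v0 ^+ 3 = - r0 * v0 ^+ 2 ->
  A * v1 ^+ 2 + B * v1 ^+ 3 = - r1 * v1 ^+ 2 ->
  B = - (r0 - r1) / (v0 - v1) /\ A = (v1 * r0 - v0 * r1) / (v0 - v1).
Proof.
move=> h0 h1 h01 E0 E1.
have d0 : v0 - v1 != 0 by rewrite subr_eq0.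
have F0 : A + B * v0 = - r0.
  by apply: (mulIf (expf_neq0 2 h0)); rewrite -E0; ring.
have F1 : A + B * v1 = - r1.
  by apply: (mulIf (expf_neq0 2 h1)); rewrite -E1; ring.
have EB : B = - (r0 - r1) / (v0 - v1).
  apply: (mulIf d0); rewrite divfK// (_ : B * _ = (A + B * v0) - (A + B * v1)); last by ring.
  by rewrite F0 F1; ring.
split=> //; have -> : A = - r0 - B * v0 by rewrite -F0 addrK.
by rewrite EB; field.
Qed.

(** Put $v_i=1/u_i$, $q_2=(u_1^3p_1-u_2^3p_2)/(u_1-u_2)$ and let $q_1$ be the fraction squared in
    the last claim. Then $u_i^3p_i=q_2u_i+q_1$, so the momentum terms of $h_1$ add up to
    $q_2^2-q_1^2/(u_1u_2)$. Subtracting $q_2^2$ leaves $-Lu_1u_2=q_1^2+a+bs+c(t+v_1v_2)$, which is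
    $c/(x_1x_2)$. In $(b/c+s)^2-2/(x_1x_2)$ the terms linear in $s$ cancel, and
    $s^2-2v_1v_2-2t=-t$. *)
Lemma vieta_interpolation (u1 u2 p1 p2 a b c x1 x2 : K) :
  let L := u1 ^+ 5 * p1 ^+ 2 / (u1 - u2) + u2 ^+ 5 * p2 ^+ 2 / (u2 - u1)
    - a / (u1 * u2) - b * (u1 + u2) / (u1 ^+ 2 * u2 ^+ 2)
    - c * (u1 ^+ 2 + u1 * u2 + u2 ^+ 2) / (u1 ^+ 3 * u2 ^+ 3)
    - ((u1 ^+ 3 * p1 - u2 ^+ 3 * p2) / (u1 - u2)) ^+ 2 in
  let S := (b * u1 * u2 + c * (u1 + u2)) / (u1 ^+ 2 * u2 ^+ 2) in
  u1 != u2 -> u1 != 0 -> u2 != 0 -> x1 != x2 -> x1 != 0 -> x2 != 0 -> L != 0 ->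
  L * x1 ^+ 2 - S * x1 - c / (u1 * u2) = 0 ->
  L * x2 ^+ 2 - S * x2 - c / (u1 * u2) = 0 ->
  [/\ c != 0,
      x1^-1 + x2^-1 = - (b / c) - (u1^-1 + u2^-1) &
      x1^-1 ^+ 2 + x2^-1 ^+ 2 = (b ^+ 2 / c ^+ 2 - 2%:R * a / c)
        - 2%:R / c * ((u1 * u2 ^+ 3 * p2 - u2 * u1 ^+ 3 * p1) / (u1 - u2)) ^+ 2
        - (u1^-1 ^+ 2 + u2^-1 ^+ 2)].
Proof.
move=> L S u12 u10 u20 x12 x10 x20 L0 E1 E2.
have du : u1 - u2 != 0 by rewrite subr_eq0.
have du' : u2 - u1 != 0 by rewrite subr_eq0 eq_sym.
have dx : x1 - x2 != 0 by rewrite subr_eq0.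
have sumE : L * (x1 + x2) = S.
  apply: (mulIf dx); apply/eqP; rewrite -subr_eq0; apply/eqP.
  rewrite (_ : _ - _ = (L * x1 ^+ 2 - S * x1 - c / (u1 * u2))
    - (L * x2 ^+ 2 - S * x2 - c / (u1 * u2))); last by ring.
  by rewrite E1 E2 subrr.
have prodE : L * (x1 * x2) = - (c / (u1 * u2)).
  have -> : L * (x1 * x2) = S * x1 - L * x1 ^+ 2 by rewrite -sumE; ring.
  rewrite (_ : _ - _ = - (c / (u1 * u2)) - (L * x1 ^+ 2 - S * x1 - c / (u1 * u2))).
    by rewrite E1 subr0.
  by ring.
(* The product of the roots is $-c/(Lu_1u_2)$, so nonzero roots force $c\ne0$ and justify every
   division by [c]. *)
have c0 : c != 0.
  apply/eqP => cz; move/eqP: prodE.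
  by rewrite cz mul0r oppr0 !mulf_eq0 (negbTE L0) (negbTE x10) (negbTE x20).
have xx : (x1 * x2)^-1 = - L * (u1 * u2) / c.
  have xx0 : x1 * x2 != 0 by rewrite mulf_neq0.
  apply: (mulIf xx0); rewrite mulVf//.
  rewrite [RHS](_ : _ = - (L * (x1 * x2)) * (u1 * u2) / c); last by ring.
  by rewrite prodE; field; rewrite c0 u10 u20.
have sE : x1^-1 + x2^-1 = - (b / c) - (u1^-1 + u2^-1).
  have -> : x1^-1 + x2^-1 = (x1 + x2) * (x1 * x2)^-1 by field; rewrite x10 x20.
  rewrite xx [LHS](_ : _ = - (L * (x1 + x2)) * (u1 * u2) / c); last by ring.
  by rewrite sumE /S; field; rewrite c0 u10 u20.
split=> //.
have -> : x1^-1 ^+ 2 + x2^-1 ^+ 2 = (x1^-1 + x2^-1) ^+ 2 - 2%:R * (x1 * x2)^-1.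
  by rewrite invfM; ring.
by rewrite sE xx /L; field; rewrite c0 u10 u20 du du'.
Qed.
End CubicAlgebra.

Section CubicBracketAlgebra.
Variable K : numFieldType.

(** Meant for $Q=\{q_1,q_2\}$, $k_0=\{v_0,q_1\}$, $k_1=\{v_0,q_2\}$ and $e=\partial p_0/\partial
    v_0$. The first equation is $\{p_0,p_1\}=0$ and the second is $\{v_0,p_1\}=0$; eliminating the
    $k_i$ leaves $Qv_0^2v_1^2(v_0-v_1)=0$. *)
Lemma cubic_commute (v0 v1 Q e k0 k1 : K) : v0 != 0 -> v1 != 0 -> v0 != v1 ->
  (Q * v0 ^+ 3 + e * k1) * v1 ^+ 2 + (- Q * v0 ^+ 2 + e * k0) * v1 ^+ 3 = 0 ->
  k1 * v1 ^+ 2 + k0 * v1 ^+ 3 = 0 -> Q = 0.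
Proof.
move=> h0 h1 h01 E Ek; have d0 : v0 - v1 != 0 by rewrite subr_eq0.
have h : v0 ^+ 2 * v1 ^+ 2 * (v0 - v1) != 0 by rewrite !mulf_neq0 ?expf_neq0.
apply: (mulIf h); rewrite mul0r.
transitivity ((Q * v0 ^+ 3 + e * k1) * v1 ^+ 2 + (- Q * v0 ^+ 2 + e * k0) * v1 ^+ 3
  - e * (k1 * v1 ^+ 2 + k0 * v1 ^+ 3)); first by ring.
by rewrite E Ek mulr0 subrr.
Qed.
End CubicBracketAlgebra.

(** * Canonical pairs and brackets of power sums *)

Section CubicRelations.
Variables (R : realType) (U : set (phase R)) (P : phase R -> 'M[R[i]]_(2 + 2)).
Hypotheses (oU : open U) (bP : bivector_field U P).
Local Notation fct := (phase R -> R[i]).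
Local Notation smooth := (smooth_on U).
Local Notation B := (bivector_bracket P).
Implicit Types (f g h q : fct).

Lemma bracket_vf f : smooth f -> vector_field U (B f).
Proof. by move=> sf; apply: bivector_vf => //; case: bP. Qed.

Lemma bracketC f g x : U x -> B f g x = - B g f x.
Proof. exact: bivector_bracketC. Qed.

Lemma bracketxx f x : U x -> B f f x = 0.
Proof.
move=> Ux; have /eqP := bracketC f f Ux.
by rewrite -addr_eq0 -mulr2n mulrn_eq0 /= => /eqP.
Qed.

Lemma vf_cubic D q1 q2 v p x : vector_field U D ->
  smooth q1 -> smooth q2 -> smooth v ->
  (forall y, U y -> p y = q2 y * v y ^+ 2 + q1 y * v y ^+ 3) -> U x ->
  D p x = D q2 x * v x ^+ 2 + D q1 x * v x ^+ 3
     + (2%:R * q2 x * v x + 3%:R * q1 x * v x ^+ 2) * D v x.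
Proof.
move=> vD s1 s2 sv pE Ux; rewrite (vf_eq vD pE Ux).
have sv2 := smooth_onX oU 2 sv; have sv3 := smooth_onX oU 3 sv.
rewrite (vfD vD (smooth_onM oU s2 sv2) (smooth_onM oU s1 sv3) Ux).
rewrite (vfM vD s2 sv2 Ux) (vfM vD s1 sv3 Ux) !(vfX oU vD _ sv Ux) /=.
by move: (D q2 x) (D q1 x) (D v x) (q1 x) (q2 x) (v x) => *; ring.
Qed.

Lemma vf_sumsq D f g x : vector_field U D -> smooth f -> smooth g -> U x ->
  D (fun y => f y ^+ 2 + g y ^+ 2) x = 2%:R * (f x * D f x + g x * D g x).
Proof.
move=> vD sf sg Ux.
rewrite (vfD vD (smooth_onX oU 2 sf) (smooth_onX oU 2 sg) Ux) !(vfX oU vD) //=.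
by move: (f x) (g x) (D f x) (D g x) => *; ring.
Qed.

(* With [p_i = q2 v_i^2 + q1 v_i^3], the pairs [(1/v_i, e p_i)] are canonical if
   and only if the power sums of the [v_i] have these brackets with [q1], [q2].
   The sign [e] is [1] for [(u_i, p_i)] and [-1] for [(uh_i, - ph_i)]. *)
Definition power_sum_relations (v0 v1 q1 q2 : fct) (e : R[i]) (x : phase R) :=
  let s := fun y => v0 y + v1 y in let t := fun y => v0 y ^+ 2 + v1 y ^+ 2 in
  [/\ B s t x = 0, B q1 q2 x = 0,
      B q1 s x = 0, B q2 s x = e &
      B q1 t x = 2%:R * e /\ B q2 t x = 0].

Section Pair.
Variables (v0 v1 q1 q2 p0 p1 : fct) (x : phase R).
Hypotheses (sv0 : smooth v0) (sv1 : smooth v1) (sq1 : smooth q1) (sq2 : smooth q2).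
Hypothesis p0E : forall y, U y -> p0 y = q2 y * v0 y ^+ 2 + q1 y * v0 y ^+ 3.
Hypothesis p1E : forall y, U y -> p1 y = q2 y * v1 y ^+ 2 + q1 y * v1 y ^+ 3.
Hypotheses (Ux : U x) (v0n0 : v0 x != 0) (v1n0 : v1 x != 0) (v01 : v0 x != v1 x).

Let vB0 := bracket_vf sv0.
Let vB1 := bracket_vf sv1.
Let vQ1 := bracket_vf sq1.
Let vQ2 := bracket_vf sq2.

Lemma power_sum_relations_of_canonical e :
  B v0 v1 x = 0 -> B p0 p1 x = 0 -> smooth p0 ->
  B v0 p0 x = - e * v0 x ^+ 2 -> B v0 p1 x = 0 ->
  B v1 p0 x = 0 -> B v1 p1 x = - e * v1 x ^+ 2 ->
  power_sum_relations v0 v1 q1 q2 e x.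
Proof.
move=> v0v1 p0p1 sp0 v0p0 v0p1 v1p0 v1p1.
have v1v0 : B v1 v0 x = 0 by rewrite bracketC// v0v1 oppr0.
move: v0p0 v0p1 v1p0 v1p1.
rewrite (vf_cubic vB0 sq1 sq2 sv0 p0E Ux) (vf_cubic vB0 sq1 sq2 sv1 p1E Ux).
rewrite (vf_cubic vB1 sq1 sq2 sv0 p0E Ux) (vf_cubic vB1 sq1 sq2 sv1 p1E Ux).
rewrite v0v1 v1v0 !bracketxx// !mulr0 !addr0 => E00 E01 E10 E11.
have [B01 B02] : B v0 q1 x = - (e - 0) / (v0 x - v1 x)
    /\ B v0 q2 x = (v1 x * e - v0 x * 0) / (v0 x - v1 x).
  by apply: cubic_solve => //; rewrite E01 oppr0 mul0r.
have [B11 B12] : B v1 q1 x = - (0 - e) / (v0 x - v1 x)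
    /\ B v1 q2 x = (v1 x * 0 - v0 x * e) / (v0 x - v1 x).
  by apply: cubic_solve => //; rewrite E10 oppr0 mul0r.
have vP0 := bracket_vf sp0.
(* The brackets with $v_0,v_1$ say nothing about $\{q_1,q_2\}$; it is extracted from
   $\{p_0,p_1\}=0$. *)
have q12 : B q1 q2 x = 0.
  move: p0p1; rewrite (vf_cubic vP0 sq1 sq2 sv1 p1E Ux).
  rewrite (bracketC p0 v1 Ux) (vf_cubic vB1 sq1 sq2 sv0 p0E Ux) E10 v1v0.
  rewrite (bracketC p0 q1 Ux) (bracketC p0 q2 Ux).
  rewrite (vf_cubic vQ1 sq1 sq2 sv0 p0E Ux) (vf_cubic vQ2 sq1 sq2 sv0 p0E Ux).
  rewrite !bracketxx// (bracketC q2 q1 Ux) (bracketC q1 v0 Ux) (bracketC q2 v0 Ux).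
  move: E01; move: (B q1 q2 x) (B v0 q1 x) (B v0 q2 x) => Q k0 k1 E01 EQ.
  move: EQ; move: (2%:R * q2 x * v1 x + _) => d1.
  move: (2%:R * q2 x * v0 x + _) => d0 EQ.
  apply: (cubic_commute (e := d0) v0n0 v1n0 v01 _ E01).
  by rewrite -[RHS]EQ; move: (v0 x) (v1 x) => *; ring.
have d0 : v0 x - v1 x != 0 by rewrite subr_eq0.
split=> //.
- rewrite (vf_sumsq (bracket_vf (smooth_onD oU sv0 sv1))) //.
  have sumC f : smooth f -> B (fun y => v0 y + v1 y) f x = - (B f v0 x + B f v1 x).
    by move=> sf; rewrite bracketC// (vfD (bracket_vf sf)).
  by rewrite !sumC// !bracketxx// v0v1 v1v0 !addr0 oppr0 !mulr0 addr0 mulr0.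
- rewrite (vfD vQ1)// (bracketC q1 v0 Ux) (bracketC q1 v1 Ux) B01 B11.
  by move: d0; move: (v0 x) (v1 x) => *; field.
- rewrite (vfD vQ2)// (bracketC q2 v0 Ux) (bracketC q2 v1 Ux) B02 B12.
  by move: d0; move: (v0 x) (v1 x) => *; field.
- rewrite !(vf_sumsq _ sv0 sv1 Ux)// (bracketC q2 v0 Ux) (bracketC q2 v1 Ux) B02 B12.
  rewrite (bracketC q1 v0 Ux) (bracketC q1 v1 Ux) B01 B11.
  by split; move: d0; move: (v0 x) (v1 x) => *; field.
Qed.

(** Since $\{s,t\}=-2(v_0-v_1)\{v_0,v_1\}$, the first relation gives $\{v_0,v_1\}=0$. For each $q_j$
    the brackets with $s$ and $t$ form a linear system in $\{q_j,v_0\},\{q_j,v_1\}$ with determinant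
    proportional to $v_0-v_1$. All brackets of the cubics $p_i$ then follow by the chain rule. *)
Lemma canonical_of_power_sum_relations e :
  smooth p0 -> power_sum_relations v0 v1 q1 q2 e x ->
  [/\ B v0 v1 x = 0 /\ B p0 p1 x = 0,
      B v0 p0 x = - e * v0 x ^+ 2, B v0 p1 x = 0,
      B v1 p0 x = 0 & B v1 p1 x = - e * v1 x ^+ 2].
Proof.
move=> sp0 [st q12 q1s q2s [q1t q2t]].
have d0 : v0 x - v1 x != 0 by rewrite subr_eq0.
have two0 : 2%:R != 0 :> R[i] by rewrite pnatr_eq0.
have v0v1 : B v0 v1 x = 0.
  move: st; rewrite (vf_sumsq (bracket_vf (smooth_onD oU sv0 sv1))) //.
  have sumC f : smooth f -> B (fun y => v0 y + v1 y) f x = - (B f v0 x + B f v1 x).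
    by move=> sf; rewrite bracketC// (vfD (bracket_vf sf)).
  rewrite !sumC// !bracketxx// (bracketC v1 v0 Ux) addr0 add0r opprK => E.
  have h : 2%:R * (v0 x - v1 x) != 0 by rewrite mulf_neq0.
  apply: (mulfI h); rewrite mulr0 -[RHS]oppr0 -E.
  by move: (v0 x) (v1 x) (B v0 v1 x) => *; ring.
have v1v0 : B v1 v0 x = 0 by rewrite bracketC// v0v1 oppr0.
have solve a b r0 r1 : a + b = r0 -> 2%:R * (v0 x * a + v1 x * b) = 2%:R * r1 ->
    a = (r1 - v1 x * r0) / (v0 x - v1 x) /\ b = (v0 x * r0 - r1) / (v0 x - v1 x).
  move=> <- /(mulfI two0) <-.
  by split; move: d0; move: (v0 x) (v1 x) => *; field.
have [B10 B11] : B q1 v0 x = (e - v1 x * 0) / (v0 x - v1 x)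
    /\ B q1 v1 x = (v0 x * 0 - e) / (v0 x - v1 x).
  by apply: solve; rewrite -?(vfD vQ1)// -?(vf_sumsq vQ1).
have [B20 B21] : B q2 v0 x = (0 - v1 x * e) / (v0 x - v1 x)
    /\ B q2 v1 x = (v0 x * e - 0) / (v0 x - v1 x).
  by apply: solve; rewrite -?(vfD vQ2)// -?(vf_sumsq vQ2)// mulr0.
have vP0 := bracket_vf sp0.
have v1p0 : B v1 p0 x = 0.
  rewrite (vf_cubic vB1 sq1 sq2 sv0 p0E Ux) v1v0.
  rewrite (bracketC v1 q1 Ux) (bracketC v1 q2 Ux) B11 B21.
  by move: d0; move: (v0 x) (v1 x) (q1 x) (q2 x) => *; field.
have v0p1 : B v0 p1 x = 0.
  rewrite (vf_cubic vB0 sq1 sq2 sv1 p1E Ux) v0v1.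
  rewrite (bracketC v0 q1 Ux) (bracketC v0 q2 Ux) B10 B20.
  by move: d0; move: (v0 x) (v1 x) (q1 x) (q2 x) => *; field.
split=> //.
- split=> //; rewrite (vf_cubic vP0 sq1 sq2 sv1 p1E Ux) (bracketC p0 v1 Ux) v1p0.
  rewrite (bracketC p0 q1 Ux) (bracketC p0 q2 Ux).
  rewrite (vf_cubic vQ1 sq1 sq2 sv0 p0E Ux) (vf_cubic vQ2 sq1 sq2 sv0 p0E Ux).
  rewrite !bracketxx// (bracketC q2 q1 Ux) q12 B10 B20.
  by move: d0; move: (v0 x) (v1 x) (q1 x) (q2 x) => *; field.
- rewrite (vf_cubic vB0 sq1 sq2 sv0 p0E Ux) bracketxx//.
  rewrite (bracketC v0 q1 Ux) (bracketC v0 q2 Ux) B10 B20.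
  by move: d0; move: (v0 x) (v1 x) (q1 x) (q2 x) => *; field.
- rewrite (vf_cubic vB1 sq1 sq2 sv1 p1E Ux) bracketxx//.
  rewrite (bracketC v1 q1 Ux) (bracketC v1 q2 Ux) B11 B21.
  by move: d0; move: (v0 x) (v1 x) (q1 x) (q2 x) => *; field.
Qed.
End Pair.
End CubicRelations.

Section Canonicity.
Variables (R : realType) (a b c : R) (U : set (phase R)) (uh : 'I_2 -> phase R -> R[i]).
Hypothesis gb : generic_branches a b c U uh.
Local Notation smooth := (smooth_on U).
Local Notation B := (bivector_bracket (@canonical_mx R)).

Let oU : open U. Proof. by case: gb. Qed.
Let bO : bivector_field U (@canonical_mx R). Proof. exact: canonical_bivector_field. Qed.

Lemma ord2_cases (i : 'I_2) : i = 0 \/ i = 1.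
Proof. by case: i => [[|[|//]]] ?; [left|right]; exact: val_inj. Qed.

Lemma ucoord_smooth i : smooth (ucoord i).
Proof. exact: smooth_on_coord. Qed.

Lemma pcoord_smooth i : smooth (pcoord i).
Proof. exact: smooth_on_coord. Qed.

Let su := ucoord_smooth.
Let sp := pcoord_smooth.
Let suh i : smooth (uh i). Proof. by case: gb. Qed.

Let ne x : U x ->
  [/\ ucoord 0 x != ucoord 1 x, ucoord 0 x != 0, ucoord 1 x != 0 & leading a b c x != 0].
Proof.
move=> Ux; case: gb => _ /(_ x (mem_set Ux))[u01 u0 L0] _ _ _; split=> //.
  by apply: contraNneq u0 => ->; rewrite mul0r.
by apply: contraNneq u0 => ->; rewrite mulr0.
Qed.

Let un0 i x : U x -> ucoord i x != 0.
Proof. by move=> /ne[_ ? ? _]; case: (ord2_cases i) => ->. Qed.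

Let du x : U x -> ucoord 0 x - ucoord 1 x != 0.
Proof. by move=> /ne[? _ _ _]; rewrite subr_eq0. Qed.

Let uhn0 i x : U x -> uh i x != 0.
Proof. by move=> Ux; case: gb => _ _ _ _ /(_ x (mem_set Ux))[_ /(_ i)[]]. Qed.

Let uh01 x : U x -> uh 0 x != uh 1 x.
Proof. by move=> Ux; case: gb => _ _ _ _ /(_ x (mem_set Ux))[]. Qed.

Lemma canonical_coord_bracket i j x :
  [/\ B (ucoord i) (pcoord j) x = (i == j)%:R,
      B (ucoord i) (ucoord j) x = 0 & B (pcoord i) (pcoord j) x = 0].
Proof.
have uu k l : partial (lshift 2 k) (@ucoord R l) x = (k == l)%:R.
  by rewrite -(inj_eq (@lshift_inj 2 2)); exact: partial_coord.
have pp k l : partial (rshift 2 k) (@pcoord R l) x = (k == l)%:R.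
  by rewrite -(inj_eq (@rshift_inj 2 2)); exact: partial_coord.
have up k l : partial (lshift 2 k) (@pcoord R l) x = 0.
  by rewrite [LHS]partial_coord eq_lrshift.
have pu k l : partial (rshift 2 k) (@ucoord R l) x = 0.
  by rewrite [LHS]partial_coord eq_rlshift.
rewrite -!canonical_bracketE /canonical_bracket; split.
- rewrite (bigD1 i)//= big1 => [|k /negPf ki]; rewrite uu pp pu mul0r subr0.
    by rewrite eqxx mul1r addr0.
  by rewrite ki mul0r.
- by rewrite big1// => k _; rewrite pu mulr0 pu mul0r subrr.
- by rewrite big1// => k _; rewrite up mul0r up mulr0 subrr.
Qed.

Let v i (x : phase R) := (ucoord i x)^-1.
Let w i (x : phase R) := (uh i x)^-1.
Let sv i : smooth (v i). Proof. by apply: smooth_onV => // x; exact: un0. Qed.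
Let sw i : smooth (w i). Proof. by apply: smooth_onV => // x; exact: uhn0. Qed.

(* [Qpol x z = z * (qlin x + qquad x * z)] *)
Definition qquad (x : phase R) : R[i] :=
  (ucoord 0 x ^+ 3 * pcoord 0 x - ucoord 1 x ^+ 3 * pcoord 1 x) / (ucoord 0 x - ucoord 1 x).
Definition qlin (x : phase R) : R[i] :=
  (ucoord 0 x * ucoord 1 x ^+ 3 * pcoord 1 x - ucoord 1 x * ucoord 0 x ^+ 3 * pcoord 0 x)
  / (ucoord 0 x - ucoord 1 x).

Let sqquad : smooth qquad.
Proof.
apply: (smooth_on_div oU du); last exact: smooth_onB.
by apply: (smooth_onB oU); apply: (smooth_onM oU) => //; exact: smooth_onX.
Qed.

Let sqlin : smooth qlin.
Proof.
apply: (smooth_on_div oU du); last exact: smooth_onB.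
by apply: (smooth_onB oU); do ![apply: (smooth_onM oU) => //]; exact: smooth_onX.
Qed.

(** $Q$ is the interpolating polynomial with $Q(0)=0$ and $Q(u_i)=u_i^4p_{u_i}$; dividing by $u_i^4$
    gives the cubic in $1/u_i$. By definition $Q(\hat u_i)=-\hat u_i^4\hat p_{u_i}$, which is the
    source of the opposite sign in [phE]. *)
Let pE i x : U x -> pcoord i x = qquad x * v i x ^+ 2 + qlin x * v i x ^+ 3.
Proof.
move=> Ux; have := du Ux; have := un0 0 Ux; have := un0 1 Ux.
rewrite /qquad /qlin /v.
case: (ord2_cases i) => ->;
  move: (ucoord 0 x) (ucoord 1 x) (pcoord 0 x) (pcoord 1 x) => u0 u1 p0 p1 h1 h0 d;
  by field; rewrite ?h0 ?h1 ?d.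
Qed.

Let phE i x : U x -> - phat uh i x = qquad x * w i x ^+ 2 + qlin x * w i x ^+ 3.
Proof.
move=> Ux; have := du Ux; have := uhn0 i Ux.
have : ucoord 1 x - ucoord 0 x != 0 by rewrite -opprB oppr_eq0; exact: du.
rewrite /phat /Qpol /qquad /qlin /w /=.
move: (ucoord 0 x) (ucoord 1 x) (pcoord 0 x) (pcoord 1 x) (uh i x) => u0 u1 p0 p1 h d' h0 d.
by field; rewrite ?h0 ?d ?d'.
Qed.

Lemma phat_smooth i : smooth (phat uh i).
Proof.
apply: (smooth_on_eq oU (F := fun x => - (qquad x * w i x ^+ 2 + qlin x * w i x ^+ 3))).
  by move=> x Ux; rewrite -phE// opprK.
apply: (smooth_onN oU); apply: (smooth_onD oU); apply: (smooth_onM oU) => //;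
  exact: smooth_onX.
Qed.

Let vieta x : U x ->
  [/\ c%:C != 0 :> R[i],
     w 0 x + w 1 x = - (b%:C / c%:C) - (v 0 x + v 1 x) &
     w 0 x ^+ 2 + w 1 x ^+ 2 = (b%:C ^+ 2 / c%:C ^+ 2 - 2%:R * a%:C / c%:C)
        - 2%:R / c%:C * qlin x ^+ 2 - (v 0 x ^+ 2 + v 1 x ^+ 2)].
Proof.
move=> Ux; have [u01 u0 u1 L0] := ne Ux.
have [_ _ _ /(_ x (mem_set Ux)) roots _] := gb.
have r0 : quadratic a b c x (uh 0 x) = 0 by apply/roots; left.
have r1 : quadratic a b c x (uh 1 x) = 0 by apply/roots; right.
exact: (vieta_interpolation u01 u0 u1 (uh01 Ux) (uhn0 0 Ux) (uhn0 1 Ux) L0 r0 r1).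
Qed.

Let v01 x : U x -> v 0 x != v 1 x.
Proof. by move=> /ne[u01 _ _ _]; rewrite /v (inj_eq invr_inj). Qed.

Let w01 x : U x -> w 0 x != w 1 x.
Proof. by move=> /uh01 u01; rewrite /w (inj_eq invr_inj). Qed.

Lemma power_sum_relations_u x : U x ->
  power_sum_relations (@canonical_mx R) (v 0) (v 1) qlin qquad 1 x.
Proof.
move=> Ux.
have vp i j : B (v i) (pcoord j) x = - (i == j)%:R * v i x ^+ 2.
  rewrite (bracketC bO)// (vfV oU (bracket_vf oU bO (sp j)) (su i))//;
    last by move=> y; exact: un0.
  rewrite (bracketC bO (pcoord j) (ucoord i) Ux) opprK.
  by have [-> _ _] := canonical_coord_bracket i j x; rewrite /v exprVn mulNr.
have vv i j : B (v i) (v j) x = 0.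
  rewrite (vfV oU (bracket_vf oU bO (sv i)) (su j))//; last by move=> y; exact: un0.
  rewrite (bracketC bO)// (vfV oU (bracket_vf oU bO (su j)) (su i))//;
    last by move=> y; exact: un0.
  have [_ -> _] := canonical_coord_bracket j i x.
  by rewrite oppr0 mul0r oppr0 oppr0 mul0r.
have [_ _ pp] := canonical_coord_bracket 0 1 x.
apply: (power_sum_relations_of_canonical oU bO (sv 0) (sv 1) sqlin sqquad (pE 0) (pE 1)) => //.
- exact: invr_neq0 (un0 0 Ux).
- exact: invr_neq0 (un0 1 Ux).
- exact: v01.
- by rewrite vp oppr0 mul0r.
- by rewrite vp oppr0 mul0r.
Qed.

(** The fields applied to [t'] are those of [s'], [qlin] and [qquad]. Each annihilates [qlin], by
    $\{q_1,s\}=0$, skew-symmetry and $\{q_1,q_2\}=0$ respectively. The term $-(2/c)q_1^2$ is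
    therefore invisible, and the new power sums act as $-s$ and $-t$. *)
Lemma power_sum_relations_uh x : U x ->
  power_sum_relations (@canonical_mx R) (w 0) (w 1) qlin qquad (-1) x.
Proof.
move=> Ux; have [st q12 q1s q2s [q1t q2t]] := power_sum_relations_u Ux.
set s := (fun y => v 0 y + v 1 y) in st q1s q2s.
set t := (fun y => v 0 y ^+ 2 + v 1 y ^+ 2) in st q1t q2t.
have ss : smooth s by exact: smooth_onD.
have stt : smooth t by apply: (smooth_onD oU); exact: smooth_onX.
have sq2 : smooth (fun y => qlin y ^+ 2) by exact: smooth_onX.
set s' := fun y => w 0 y + w 1 y; set t' := fun y => w 0 y ^+ 2 + w 1 y ^+ 2.
have Ds D : vector_field U D -> D s' x = - D s x.
  move=> vD; rewrite (@vf_eq _ _ _ _ vD _ (fun y => - (b%:C / c%:C) - s y)) //.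
    rewrite (vfB oU vD (smooth_on_cst _ _) ss Ux) (vf_cst vD)// sub0r//.
  by move=> y /vieta[_ E _]; exact: E.
have Dt D : vector_field U D -> D qlin x = 0 -> D t' x = - D t x.
  move=> vD Dq.
  rewrite (@vf_eq _ _ _ _ vD _ (fun y => (b%:C ^+ 2 / c%:C ^+ 2 - 2%:R * a%:C / c%:C)
        - 2%:R / c%:C * qlin y ^+ 2 - t y)) //; last by move=> y /vieta[_ _ E]; exact: E.
  have sc (z : R[i]) : smooth (fun=> z) by exact: smooth_on_cst.
  rewrite (vfB oU vD (smooth_onB oU (sc _) (smooth_onM oU (sc _) sq2)) stt Ux).
  rewrite (vfB oU vD (sc _) (smooth_onM oU (sc _) sq2) Ux) (vf_cst vD)//.
  by rewrite (vfZ vD _ sq2 Ux) (vfX oU vD _ sqlin Ux) Dq !mulr0 subrr sub0r.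
have vB f : smooth f -> vector_field U (B f) by exact: bracket_vf.
have ss' : smooth s' by exact: smooth_onD.
have s'C f : smooth f -> B s' f x = - B s f x.
  by move=> sf; rewrite (bracketC bO)// (Ds _ (vB f sf)) -(bracketC bO).
split.
- rewrite -/s' -/t' (Dt _ (vB s' ss')) s'C// ?st ?oppr0//.
  by rewrite (bracketC bO)// q1s !oppr0.
- exact: q12.
- by rewrite -/s' (Ds _ (vB _ sqlin)) q1s oppr0.
- by rewrite -/s' (Ds _ (vB _ sqquad)) q2s.
- rewrite -/t' (Dt _ (vB _ sqlin)) ?(bracketxx bO)// q1t mulrN; split=> //.
  by rewrite (Dt _ (vB _ sqquad)) ?q2t ?oppr0// (bracketC bO)// q12 oppr0.
Qed.

Lemma hat_canonical :
  diagonal_relations U B uh (phat uh) (fun _ _ => 1).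
Proof.
move=> i j x xU; have Ux := set_mem xU.
have vB f : smooth f -> vector_field U (B f) by exact: bracket_vf.
pose p' k y := - phat uh k y.
have sp' k : smooth (p' k) by apply: (smooth_onN oU); exact: phat_smooth.
have [[ww pp] w0p0 w0p1 w1p0 w1p1] := canonical_of_power_sum_relations oU bO
  (sw 0) (sw 1) sqlin sqquad (phE 0) (phE 1) Ux (w01 Ux) (sp' 0) (power_sum_relations_uh Ux).
(* Here $e=-1$, so $\{w_k,-\hat p_k\}=w_k^2$. With $d\hat u_k=-dw_k/w_k^2$ the two minus signs
   cancel and $\{\hat u_k,\hat p_k\}=1$. *)
have WP k l : B (w k) (p' l) x = (k == l)%:R * w k x ^+ 2.
  by case: (ord2_cases k) => ->; case: (ord2_cases l) => ->;
    rewrite ?w0p0 ?w0p1 ?w1p0 ?w1p1 ?opprK ?mul0r.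
have WW k l : B (w k) (w l) x = 0.
  by case: (ord2_cases k) => ->; case: (ord2_cases l) => ->;
    rewrite ?(bracketxx bO)// (bracketC bO)// ww oppr0.
have PP k l : B (p' k) (p' l) x = 0.
  by case: (ord2_cases k) => ->; case: (ord2_cases l) => ->;
    rewrite ?(bracketxx bO)// (bracketC bO)// pp oppr0.
have uhE k y : U y -> uh k y = (w k y)^-1 by rewrite /w invrK.
have phE' k y : U y -> phat uh k y = - p' k y by rewrite /p' opprK.
have Duh D k : vector_field U D -> D (uh k) x = - D (w k) x / w k x ^+ 2.
  move=> vD; rewrite (vf_eq vD (uhE k) Ux) (vfV oU vD (sw k))// => y Uy.
  exact: invr_neq0 (uhn0 k Uy).
have Dph D k : vector_field U D -> D (phat uh k) x = - D (p' k) x.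
  by move=> vD; rewrite (vf_eq vD (phE' k) Ux) (vfN vD (sp' k)).
have wn0 k : w k x ^+ 2 != 0 by rewrite expf_neq0// invr_neq0// uhn0.
split.
- rewrite (Dph _ _ (vB _ (suh i))) (bracketC bO)// opprK (Duh _ _ (vB _ (sp' j))).
  by rewrite -(bracketC bO)// WP mulfK// mul1r.
- rewrite (Duh _ _ (vB _ (suh i))) (bracketC bO)// opprK (Duh _ _ (vB _ (sw j))).
  by rewrite WW oppr0 mul0r mul0r.
- rewrite (Dph _ _ (vB _ (phat_smooth i))) (bracketC bO)// opprK (Dph _ _ (vB _ (sp' j))).
  by rewrite PP oppr0.
Qed.
End Canonicity.

(** * The two brackets *)

Section WedgeMatrix.
Variables (C : comNzRingType) (n : nat).
Implicit Types (s : C) (x y g h : 'rV[C]_n).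

Lemma wedge_entry s x y k l : (s *: (x^T *m y - y^T *m x)) k l
  = s * (x ord0 k * y ord0 l - y ord0 k * x ord0 l).
Proof. by rewrite !mxE !big_ord1 !mxE. Qed.

Lemma wedge_skew s x y : (s *: (x^T *m y - y^T *m x))^T = - (s *: (x^T *m y - y^T *m x)).
Proof. by apply/matrixP => k l; rewrite mxE [RHS]mxE !wedge_entry; ring. Qed.

Lemma wedge_pairing s x y g h : (g *m (s *: (x^T *m y - y^T *m x)) *m h^T) ord0 ord0
  = s * ((x *m g^T) ord0 ord0 * (y *m h^T) ord0 ord0
         - (y *m g^T) ord0 ord0 * (x *m h^T) ord0 ord0).
Proof.
have pair (z t : 'rV[C]_n) : (g *m (z^T *m t) *m h^T) ord0 ord0
    = (z *m g^T) ord0 ord0 * (t *m h^T) ord0 ord0.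
  rewrite mulmxA -mulmxA [LHS]mxE big_ord1; congr (_ * _).
  by rewrite -[g in LHS]trmxK -trmx_mul mxE.
rewrite -scalemxAr -scalemxAl mxE mulmxBr mulmxBl; congr (_ * _).
by rewrite [LHS]mxE [X in _ + X]mxE !pair.
Qed.
End WedgeMatrix.

Section HatBrackets.
Variables (R : realType) (U : set (phase R)) (q p : 'I_2 -> phase R -> R[i]).
Hypotheses (oU : open U) (sq : forall i, smooth_on U (q i)) (sp : forall i, smooth_on U (p i)).
Local Notation smooth := (smooth_on U).
Local Notation B := (bivector_bracket (@canonical_mx R)).
Hypothesis rel : diagonal_relations U B q p (fun _ _ => 1).
Local Notation hat_bracket := (frame_bracket (fun i => B (q i)) (fun i => B (p i))).

Let bO : bivector_field U (@canonical_mx R). Proof. exact: canonical_bivector_field. Qed.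
Let vB f : smooth f -> vector_field U (B f). Proof. exact: bracket_vf. Qed.

Lemma hat_bracket_relations s :
  (forall i j x, U x -> [/\ hat_bracket s (q i) (p j) x = s i x * (i == j)%:R,
     hat_bracket s (q i) (q j) x = 0 & hat_bracket s (p i) (p j) x = 0]).
Proof.
move=> i j x Ux; have xU := mem_set Ux.
have qp k l : B (q k) (p l) x = (k == l)%:R by have [-> _ _] := rel k l xU; rewrite mul1r.
have qq k l : B (q k) (q l) x = 0 by have [_ -> _] := rel k l xU.
have pp k l : B (p k) (p l) x = 0 by have [_ _ ->] := rel k l xU.
have pq k l : B (p k) (q l) x = - (l == k)%:R by rewrite (bracketC bO)// qp.
split.
- rewrite /frame_bracket (bigD1 i)//= big1 => [|k /negPf ki].
    by rewrite qq mul0r pq qp eqxx mulN1r sub0r opprK addr0.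
  by rewrite qq mul0r pq eq_sym ki oppr0 mul0r subrr mulr0.
- by rewrite /frame_bracket big1// => k _; rewrite !qq mul0r mulr0 subrr mulr0.
- by rewrite /frame_bracket big1// => k _; rewrite !pp mul0r mulr0 subrr mulr0.
Qed.

Lemma hat_bracket_Poisson s : (forall i, smooth (s i)) ->
  (forall i j x, U x -> i != j -> B (q i) (s j) x = 0) ->
  (forall i j x, U x -> i != j -> B (p i) (s j) x = 0) ->
  is_Poisson U (hat_bracket s).
Proof.
move=> ss sqs sps.
have comm f g z F x : smooth f -> smooth g -> smooth F ->
    (forall y, U y -> B f g y = z) -> U x -> B f (B g F) x = B g (B f F) x.
  move=> sf sg sF fgz Ux.
  exact: (hamiltonian_commute oU bO (canonical_Poisson oU) sf sg sF fgz Ux).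
apply: (frame_Poisson oU).
- by move=> i; exact: vB.
- by move=> i; exact: vB.
- move=> i j F x sF Ux; apply: (comm _ _ 0) => // y Uy.
  by have [_ -> _] := rel i j (mem_set Uy).
- move=> i j F x sF Ux; apply: (comm _ _ 0) => // y Uy.
  by have [_ _ ->] := rel i j (mem_set Uy).
- move=> i j F x sF Ux; apply: (comm _ _ (i == j)%:R) => // y Uy.
  by have [-> _ _] := rel i j (mem_set Uy); rewrite mul1r.
- exact: ss.
- exact: sqs.
- exact: sps.
Qed.

(** The witness for the second bracket. The rows [dq i] and [dp i] are the components of the
    canonical Hamiltonian fields of [q i] and [p i], so this is the bivector $\sum_i
    s_iX_{q_i}\wedge X_{p_i}$. *)
Definition hat_mx (s : 'I_2 -> phase R -> R[i]) (x : phase R) : 'M[R[i]]_(2 + 2) :=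
  let dq i := gradient (q i) x *m canonical_mx x in
  let dp i := gradient (p i) x *m canonical_mx x in
  \sum_(i < 2) s i x *: ((dq i)^T *m dp i - (dp i)^T *m dq i).

Lemma hat_mxE s F G x : bivector_bracket (hat_mx s) F G x = hat_bracket s F G x.
Proof.
rewrite bivector_bracketE /hat_mx mulmx_sumr mulmx_suml summxE.
apply: eq_bigr => i _.
by rewrite wedge_pairing -!bivector_bracketE.
Qed.

Lemma hat_mx_bivector s : (forall i, smooth (s i)) -> bivector_field U (hat_mx s).
Proof.
move=> ss.
have sg f k : smooth f -> smooth (fun x => (gradient f x *m canonical_mx x) ord0 k).
  move=> sf; apply: (smooth_on_eq oU
    (F := fun x => \sum_j partial j f x * symplectic_mx (1%:M : 'M[R[i]]_2) j k)).
    by move=> x _; rewrite [RHS]mxE; apply: eq_bigr => j _; rewrite [gradient _ _ _ _]mxE.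
  apply: (smooth_on_sum oU) => j; apply: (smooth_onM oU); last exact: smooth_on_cst.
  exact: smooth_on_partial.
split=> [k l|x _].
  pose dq i x := (gradient (q i) x *m canonical_mx x) ord0.
  pose dp i x := (gradient (p i) x *m canonical_mx x) ord0.
  apply: (smooth_on_eq oU
    (F := fun x => \sum_(i < 2) s i x * (dq i x k * dp i x l - dp i x k * dq i x l))).
    by move=> x _; rewrite /hat_mx summxE; apply: eq_bigr => i _; rewrite wedge_entry.
  apply: (smooth_on_sum oU) => i; apply: (smooth_onM oU); first exact: ss.
  by apply: (smooth_onB oU); apply: (smooth_onM oU); exact: sg.
rewrite /hat_mx linear_sum -sumrN; apply: eq_bigr => i _ /=.
by rewrite wedge_skew.
Qed.
End HatBrackets.

(** * The functions $\lambda_i$ and involution *)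

Section Lambda.
Variables (R : realType) (a b c : R) (U : set (phase R)) (uh : 'I_2 -> phase R -> R[i]).
Hypothesis gb : generic_branches a b c U uh.
Local Notation smooth := (smooth_on U).
Local Notation lam := (lambda a b c uh).

Let oU : open U. Proof. by case: gb. Qed.
Let suh i : smooth (uh i). Proof. by case: gb. Qed.
Let uhn0 i x : U x -> uh i x != 0.
Proof. by move=> Ux; case: gb => _ _ _ _ /(_ x (mem_set Ux))[_ /(_ i)[]]. Qed.

Lemma lambda_neq0 i x : U x -> lam i x != 0.
Proof. by move=> Ux; case: gb => _ _ _ _ /(_ x (mem_set Ux))[_ /(_ i)[]]. Qed.

(** Smoothness and a vanishing derivative are carried together through the arithmetic that builds
    [lam i], since each differentiation rule asks for smooth operands. The set [A] keeps the
    vanishing pointwise. Smoothness of [lam i] alone is read off with an arbitrary field. *)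
Let kills (D : (phase R -> R[i]) -> phase R -> R[i]) (A : set (phase R)) F :=
  smooth F /\ forall x, U x -> A x -> D F x = 0.

Let kills_lambda D i : vector_field U D ->
  kills D [set x | D (uh i) x = 0 /\ D (phat uh i) x = 0] (lam i).
Proof.
move=> vD; set A := [set x | _].
have kc z : kills D A (fun=> z).
  by split=> [|x Ux _]; [exact: smooth_on_cst|exact: (vf_cst vD)].
have kM F G : kills D A F -> kills D A G -> kills D A (fun y => F y * G y).
  move=> [sF DF] [sG DG]; split=> [|x Ux Ax]; first exact: smooth_onM.
  by rewrite (vfM vD sF sG Ux) DF// DG// mulr0 mul0r addr0.
have kD F G : kills D A F -> kills D A G -> kills D A (fun y => F y + G y).
  move=> [sF DF] [sG DG]; split=> [|x Ux Ax]; first exact: smooth_onD.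
  by rewrite (vfD vD sF sG Ux) DF// DG// addr0.
have kX n F : kills D A F -> kills D A (fun y => F y ^+ n).
  move=> [sF DF]; split=> [|x Ux Ax]; first exact: smooth_onX.
  by rewrite (vfX oU vD n sF Ux) DF// mulr0.
have un0 n x : U x -> uh i x ^+ n != 0 by move=> Ux; rewrite expf_neq0// uhn0.
have sun n := smooth_onX oU n (suh i).
have kV n z : kills D A (fun y => z / uh i y ^+ n).
  apply: (kM _ _ (kc z)); split=> [|x Ux [Du _]].
    exact: (smooth_onV oU (un0 n) (sun n)).
  rewrite (vfV oU vD (sun n) (un0 n) Ux).
  by rewrite (vfX oU vD n (suh i) Ux) Du mulr0 oppr0 mul0r.
have ku : kills D A (uh i) by split=> // x Ux [].
have kp : kills D A (phat uh i) by split=> [|x Ux []]; first exact: (phat_smooth gb).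
apply: (kM _ _ (kc _)); apply: (kD _ _ _ (kV 4 _)); apply: (kD _ _ _ (kV 3 _)).
by apply: (kD _ _ _ (kV 2 _)); apply: kM; exact: kX.
Qed.

Lemma lambda_smooth i : smooth (lam i).
Proof. by case: (kills_lambda i (vf_partial oU 0)). Qed.

Lemma vf_lambda D i x : vector_field U D -> U x ->
  D (uh i) x = 0 -> D (phat uh i) x = 0 -> D (lam i) x = 0.
Proof. by move=> vD Ux Du Dp; case: (kills_lambda i vD) => _; apply. Qed.
End Lambda.

(** $\{l_0+l_1,(l_0-l_1)^2\}=2(l_0-l_1)\{l_0+l_1,l_0-l_1\}=-4(l_0-l_1)\{l_0,l_1\}$, whatever the
    bivector. *)
Lemma hat_involution (R : realType) (U : set (phase R)) P (l0 l1 : phase R -> R[i]) x :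
  open U -> bivector_field U P -> smooth_on U l0 -> smooth_on U l1 -> U x ->
  bivector_bracket P l0 l1 x = 0 ->
  bivector_bracket P (fun y => l0 y + l1 y) (fun y => (l0 y - l1 y) ^+ 2) x = 0.
Proof.
move=> oU bP s0 s1 Ux l01; set B := bivector_bracket P in l01 *.
have vB f : smooth_on U f -> vector_field U (B f) by exact: bracket_vf.
have s2 : smooth_on U (fun y => l0 y + l1 y) by exact: smooth_onD.
have bC f g : B f g x = - B g f x by exact: (bracketC bP).
have bb f : B f f x = 0 by exact: (bracketxx bP).
have l10 : B l1 l0 x = 0 by rewrite bC l01 oppr0.
rewrite (vfX oU (vB _ s2) 2 (smooth_onB oU s0 s1) Ux).
rewrite (vfB oU (vB _ s2) s0 s1 Ux) [B _ l0 x]bC [B _ l1 x]bC.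
rewrite (vfD (vB _ s0) s0 s1 Ux) (vfD (vB _ s1) s0 s1 Ux).
by rewrite !bb l01 l10 !addr0 !oppr0 addr0 mulr0.
Qed.

(** * Assembly of the result *)

Unset Implicit Arguments.
Set Strict Implicit.

Theorem proposition3 (R : realType) (a b c : R) (U : set (phase R))
    (uh : 'I_2 -> phase R -> R[i]) :
  generic_branches a b c U uh ->
  let ph := phat uh in
  let lam := lambda a b c uh in
  let H1 := Hhat1 a b c uh in
  let H2 := Hhat2 a b c uh in
  let given1 P := bivector_field U P /\
    diagonal_relations U (bivector_bracket P) uh ph (fun _ _ => 1) in
  let given2 P := bivector_field U P /\
    diagonal_relations U (bivector_bracket P) uh ph (fun i x => (lam i x)^-1) in
  [/\ exists P, given1 P,
      exists P', given2 P' &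
      forall P P', given1 P -> given2 P' ->
      let B := bivector_bracket P in
      let B' := bivector_bracket P' in
      [/\ forall F G, smooth_on U F -> smooth_on U G ->
            {in U, B F G =1 canonical_bracket F G},
          is_Poisson U B /\ is_Poisson U B',
          compatible U B B',
          {in U, forall x, B H1 H2 x = 0} &
          {in U, forall x, B' H1 H2 x = 0}]].
Proof.
move=> gb ph lam H1 H2 given1 given2.
have oU : open U by case: gb.
have suh i : smooth_on U (uh i) by case: gb.
have sph i : smooth_on U (ph i) by exact: (phat_smooth gb).
have slam i : smooth_on U (lam i) by exact: (lambda_smooth gb).
have lam0 i x : U x -> lam i x != 0 by exact: (lambda_neq0 gb).
have slamV i : smooth_on U (fun x => (lam i x)^-1).
  exact: (smooth_onV oU (lam0 i) (slam i)).
have bO := canonical_bivector_field U.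
have rel : diagonal_relations U (bivector_bracket (@canonical_mx R)) uh ph (fun _ _ => 1).
  exact: (hat_canonical gb).
set O := bivector_bracket (@canonical_mx R) in rel *.
have vO f : smooth_on U f -> vector_field U (O f) by exact: bracket_vf.
pose W := frame_bracket (fun i => O (uh i)) (fun i => O (ph i)).
(* The values [(1, 0)] and [(0, 1)] of [(al, be)] give the two brackets of the claim, so one Jacobi
   identity for this family covers both brackets and all their combinations. *)
pose wt (al be : R[i]) (i : 'I_2) x := al + be * (lam i x)^-1.
have O_uh_lam i j x : U x -> i != j -> O (uh i) (lam j) x = 0.
  move=> Ux ij; have [qp qq _] := rel i j x (mem_set Ux).
  apply: (vf_lambda gb (vO _ (suh i)) Ux) => //.
  by rewrite qp (negPf ij) mulr0.
have O_ph_lam i j x : U x -> i != j -> O (ph i) (lam j) x = 0.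
  move=> Ux ij; have [qp _ _] := rel j i x (mem_set Ux).
  have [_ _ pp] := rel i j x (mem_set Ux).
  apply: (vf_lambda gb (vO _ (sph i)) Ux) => //.
  by rewrite [LHS](bracketC bO)// [X in - X]qp eq_sym (negPf ij) mulr0 oppr0.
have vf_wt D al be i x : vector_field U D -> U x -> D (lam i) x = 0 ->
    D (wt al be i) x = 0.
  move=> vD Ux Dl.
  rewrite (vfD vD (smooth_on_cst U al) (smooth_onM oU (smooth_on_cst U be) (slamV i)) Ux).
  rewrite (vf_cst vD al Ux) (vfZ vD be (slamV i) Ux) (vfV oU vD (slam i) (lam0 i) Ux).
  by rewrite Dl oppr0 mul0r mulr0 addr0.
have W_Poisson al be : is_Poisson U (W (wt al be)).
  apply: (hat_bracket_Poisson oU suh sph rel) => [i|i j x Ux ij|i j x Ux ij].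
  - by apply: (smooth_onD oU); [|apply: (smooth_onM oU)] => //; exact: smooth_on_cst.
  - exact: vf_wt (vO _ (suh i)) Ux (O_uh_lam i j x Ux ij).
  - exact: vf_wt (vO _ (sph i)) Ux (O_ph_lam i j x Ux ij).
(* In the summand of index $i$ both products contain a derivative of the $\lambda_j$ with $j\ne i$,
   which the fields of index $i$ annihilate. The weights are arbitrary, so both involutions
   follow. *)
have W_lam s x : U x -> W s (lam 0) (lam 1) x = 0.
  move=> Ux; apply: big1 => i _.
  have [->|->] := ord2_cases i.
    by rewrite (O_uh_lam 0 1)// (O_ph_lam 0 1)// !mulr0 subrr mulr0.
  by rewrite (O_uh_lam 1 0)// (O_ph_lam 1 0)// !mul0r subrr mulr0.
split=> [||P P' [bP relP] [bP' relP'] B B'].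
- by exists (@canonical_mx R).
- exists (hat_mx uh ph (fun i x => (lam i x)^-1)); split.
    exact: (hat_mx_bivector oU suh sph slamV).
  move=> i j x xU; have Ux := set_mem xU; rewrite !hat_mxE.
  exact: (hat_bracket_relations rel).
have BE F G x : U x -> B F G x = W (fun _ _ => 1) F G x.
  by move=> Ux; exact: (bivector_bracket_frame F G bP relP rel Ux).
have B'E F G x : U x -> B' F G x = W (fun i x => (lam i x)^-1) F G x.
  by move=> Ux; exact: (bivector_bracket_frame F G bP' relP' rel Ux).
have combE al be F G x : U x -> W (wt al be) F G x = al * B F G x + be * B' F G x.
  move=> Ux; rewrite BE// B'E// /W /frame_bracket !mulr_sumr -big_split.
  apply: eq_bigr => i _ /=; rewrite /wt.
  by rewrite mulrDl mul1r mulrA.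
have B_Poisson al be : is_Poisson U (fun F G x => al * B F G x + be * B' F G x).
  by apply: (is_Poisson_ext oU _ (W_Poisson al be)) => F G _ _ x Ux; exact: combE.
split.
(* The canonical bivector satisfies the same relations as [P], so both have the same expression in
   the frame. *)
- move=> F G _ _ x xU; have Ux := set_mem xU; rewrite canonical_bracketE BE//.
  by symmetry; exact: (bivector_bracket_frame F G bO rel rel Ux).
- split.
    apply: (is_Poisson_ext oU _ (B_Poisson 1 0)) => F G _ _ x _.
    by rewrite mul1r mul0r addr0.
  apply: (is_Poisson_ext oU _ (B_Poisson 0 1)) => F G _ _ x _.
  by rewrite mul1r mul0r add0r.
- exact: B_Poisson.
- move=> x xU; have Ux := set_mem xU.
  by apply: (hat_involution oU bP (slam 0) (slam 1) Ux); rewrite -/B BE// W_lam.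
- move=> x xU; have Ux := set_mem xU.
  by apply: (hat_involution oU bP' (slam 0) (slam 1) Ux); rewrite -/B' B'E// W_lam.
Qed.
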